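(* The $E_9$-Subdivision problem can be solved in $O(n^7(n+m))$ time, where $n$ and $m$ are the numbers of vertices and arcs of the input digraph.
   Context: All digraphs are strict. $E_9$ is the digraph with vertex set $\{a,b,c,d\}$ and arc set $\{ab,ba,ac,ca,bd,dc\}$ (two directed $2$-cycles through $a$, together with a directed path $b\,d\,c$ of length $2$). A subdivision of a digraph $F$ (an $F$-subdivision) is a digraph obtained from $F$ by replacing each arc $xy$ of $F$ by a directed path from $x$ to $y$. The $F$-Subdivision problem: given a digraph $D$, decide whether $D$ contains an $F$-subdivision as a subdigraph. *)

(* Defs.v *)
From mathcomp Require Import all_boot.

Set Implicit Arguments.
Unset Strict Implicit.
Unset Printing Implicit Defensive.

(* Strict digraphs: a relation excludes parallel arcs; 2-cycles are allowed. *)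
Record digraph (V : finType) := Digraph {
  arc : rel V;
  arc_irr : irreflexive arc
}.

Definition arc_pred (V : finType) (D : digraph V) : pred (V * V) :=
  fun p => arc D p.1 p.2.

Definition arc_type (V : finType) (D : digraph V) := {p : V * V | arc_pred D p}.

Definition narcs (V : finType) (D : digraph V) : nat := #|arc_pred D|.

Definition contains (U V : finType) (H : digraph U) (D : digraph V) : Prop :=
  exists h : U -> V, injective h /\ forall x y, arc H x y -> arc D (h x) (h y).

(* The subdivision of F in which every arc e = xy is replaced by a directed   *)
(* path from x to y with l e new internal vertices; l e = 0 keeps the arc.    *)
Section Subdivision.
Variables (V : finType) (F : digraph V) (l : arc_type F -> nat).

Definition subdiv_vertex : finType := (V + {e : arc_type F & 'I_(l e)})%type.

Definition subdiv_arc (u v : subdiv_vertex) : bool :=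
  match u, v with
  | inl x, inl y => [exists e : arc_type F, (val e == (x, y)) && (l e == 0)]
  | inl x, inr q => (x == (val (tag q)).1) && (tagged q == 0 :> nat)
  | inr p, inl y => (y == (val (tag p)).2) && ((tagged p).+1 == l (tag p))
  | inr p, inr q => (tag p == tag q) && ((tagged p).+1 == tagged q :> nat)
  end.

Lemma subdiv_arc_irr : irreflexive subdiv_arc.
Proof.
case=> [x|p] /=; last by rewrite gtn_eqF ?andbF.
apply/existsP => -[[e He]] /= /andP[/eqP exx _].
by move: He; rewrite exx /arc_pred /= arc_irr.
Qed.

Definition subdivision : digraph subdiv_vertex := Digraph subdiv_arc_irr.
End Subdivision.

Definition has_subdivision (U V : finType) (F : digraph U) (D : digraph V) :
  Prop := exists l : arc_type F -> nat, contains (subdivision l) D.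

(* a, b, c, d are 0, 1, 2, 3. *)
Definition E9_arc : rel 'I_4 := fun x y =>
  (nat_of_ord x, nat_of_ord y) \in
    [:: (0, 1); (1, 0); (0, 2); (2, 0); (1, 3); (3, 2)].

Lemma E9_arc_irr : irreflexive E9_arc.
Proof. by case=> [[|[|[|[|i]]]] Hi]. Qed.

Definition E9 : digraph 'I_4 := Digraph E9_arc_irr.

(* Random-access machine, in structured form: registers (a program names only *)
(* finitely many), a memory with indirect addressing, and unit-cost           *)
(* operations; Sub is truncated subtraction.                                  *)
Inductive expr :=
| Const of nat
| Reg of nat
| Mem of expr
| Add of expr & expr
| Sub of expr & expr
| Mul of expr & expr.

Inductive cmd :=
| Skip
| Assign of nat & expr
| Store of expr & expr
| Seq of cmd & cmd
| If of expr & cmd & cmd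
| While of expr & cmd.

Record state := State { reg : nat -> nat; mem : nat -> nat }.

Fixpoint eval (s : state) (e : expr) : nat :=
  match e with
  | Const k => k
  | Reg r => reg s r
  | Mem e1 => mem s (eval s e1)
  | Add e1 e2 => eval s e1 + eval s e2
  | Sub e1 e2 => eval s e1 - eval s e2
  | Mul e1 e2 => eval s e1 * eval s e2
  end.

Fixpoint cost (e : expr) : nat :=
  match e with
  | Const _ | Reg _ => 1
  | Mem e1 => (cost e1).+1
  | Add e1 e2 | Sub e1 e2 | Mul e1 e2 => (cost e1 + cost e2).+1
  end.

Definition set_reg (s : state) (r v : nat) : state :=
  State [eta reg s with r |-> v] (mem s).

Definition set_mem (s : state) (a v : nat) : state :=
  State (reg s) [eta mem s with a |-> v].

(* exec W c s t s': from s, the command c halts in s' after t time units, all *)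
(* values written and all addresses written to being less than W.  There is   *)
(* no derivation if a write exceeds W or if c diverges.  Since programs are   *)
(* fixed, a polynomial W keeps all subexpressions polynomially bounded too,   *)
(* so that unit-cost arithmetic acts on words of logarithmic length.          *)
Inductive exec (W : nat) : cmd -> state -> nat -> state -> Prop :=
| exec_Skip s :
    exec W Skip s 1 s
| exec_Assign r e s :
    eval s e < W ->
    exec W (Assign r e) s (cost e).+1 (set_reg s r (eval s e))
| exec_Store a e s :
    eval s a < W -> eval s e < W ->
    exec W (Store a e) s (cost a + cost e).+1 (set_mem s (eval s a) (eval s e))
| exec_Seq c1 c2 s t1 s1 t2 s2 :
    exec W c1 s t1 s1 -> exec W c2 s1 t2 s2 ->
    exec W (Seq c1 c2) s (t1 + t2) s2
| exec_IfTrue e c1 c2 s t s' :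
    eval s e != 0 -> exec W c1 s t s' ->
    exec W (If e c1 c2) s ((cost e).+1 + t) s'
| exec_IfFalse e c1 c2 s t s' :
    eval s e = 0 -> exec W c2 s t s' ->
    exec W (If e c1 c2) s ((cost e).+1 + t) s'
| exec_WhileTrue e c s t1 s1 t2 s2 :
    eval s e != 0 -> exec W c s t1 s1 -> exec W (While e c) s1 t2 s2 ->
    exec W (While e c) s ((cost e).+1 + t1 + t2) s2
| exec_WhileFalse e c s :
    eval s e = 0 ->
    exec W (While e c) s (cost e).+1 s.

(* Input encoding: n, m, then the tail and head of every arc, for an arc list *)
(* in arbitrary order.  Adjacency lists can be built from it, and conversely, *)
(* in time O(n + m).                                                          *)
Definition input_state (n : nat) (arcs : seq ('I_n * 'I_n)) : state :=
  State (fun=> 0)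
    (nth 0 [:: n, size arcs &
            flatten [seq [:: nat_of_ord p.1; nat_of_ord p.2] | p <- arcs]]).

(* One program decides Pi, answering in register 0, on all digraphs, with     *)
(* words of O(log (n + m)) bits and in time O(f n m).  The bound is imposed   *)
(* for n > 0 only: for n = 0 a polynomial f may vanish.                       *)
Definition solvable_in_time (Pi : forall n, digraph 'I_n -> Prop)
    (f : nat -> nat -> nat) : Prop :=
  exists (P : cmd) (k C : nat),
  forall (n : nat) (D : digraph 'I_n) (arcs : seq ('I_n * 'I_n)),
  perm_eq arcs (enum (arc_pred D)) ->
  exists (t : nat) (s : state),
    [/\ exec ((n + narcs D + 2) ^ k) P (input_state arcs) t s,
        reg s 0 != 0 <-> Pi n D
      & 0 < n -> t <= C * f n (narcs D)].

(* Main.v *)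
(* A subdivision of E9 whose branch vertex of degree 4 is a consists of two
   disjoint paths X, Y of D - a from S = {s1, s2} to T = {t1, t2}, where a -> si
   and ti -> a, and of a path of length at least 2 from X to Y that is otherwise
   disjoint from them (a bridge).  Guess a, s1, s2, t1, t2, and suppose that no
   single vertex meets all S-T paths.  Call {u, v} a cut if it meets all S-T
   paths, and a vertex essential if it lies in a cut.  Then X, Y and a bridge
   exist iff there are essential u, w, joined by a path whose interior is
   nonempty and has no essential vertex, which are not linked by a walk of even
   length in the graph of cuts.

   If they exist, follow X back from the start of the bridge and Y forward from
   its end to the nearest essential vertices u and w; every cut has one vertex
   on X and one on Y, so an even walk of cuts cannot lead from u to w.
   Conversely, let X, Y be given by Menger's theorem and suppose that no bridge
   exists for any such pair.  An end of an arc between X and Y cannot be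
   bypassed (otherwise bypass it and use it in a bridge), and a vertex that
   cannot be bypassed is essential.  Hence u and w lie on the same path, for every
   choice of X and Y.  If two consecutive essential vertices between u and w
   had no common partner in a cut, there would be two crossing arcs between X
   and Y with which to exchange the tails of X and Y, separating u from w.

   All relations involved are tabulated by at most eight nested loops over the
   vertices, transitive closures being computed by Warshall's algorithm. *)
From Stdlib Require Import Classical.
Require Import Defs.
From mathcomp Require Import all_boot.
From mathcomp Require Import zify.

Set Implicit Arguments.
Unset Strict Implicit.
Unset Printing Implicit Defensive.

(** * Menger's theorem for two paths *)

Section Walks.
Variable V : finType.
Implicit Types (e : rel V) (A B : pred V) (p q : seq V).

(** A single vertex of both [A] and [B] counts as a walk, so overlapping terminal sets are
    covered. *)
Definition walk e A B p :=
  if p is x :: q then [&& A x, path e x q & B (last x q)] else false.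

Lemma walk_split e A B p q v :
  walk e A B (p ++ v :: q) =
  walk e A (pred1 v) (rcons p v) && walk e (pred1 v) B (v :: q).
Proof.
case: p => [|x p] /=; first by rewrite eqxx /= andbT.
by rewrite last_cat cat_path rcons_path last_rcons /= eqxx -!andbA.
Qed.

Lemma walk_cons e A B x y p :
  walk e A B [:: x, y & p] = [&& A x, e x y & walk e (pred1 y) B (y :: p)].
Proof. by rewrite /= eqxx -!andbA. Qed.

Lemma walk_uniq e A B p : walk e A B p ->
  exists q, [/\ walk e A B q, uniq q & {subset q <= p}].
Proof.
case: p => //= x p /and3P[Ax].
case/shortenP=> q pq uq sq Bq; exists (x :: q); split=> //=; first exact/and3P.
by move=> v; rewrite !inE => /orP[->//|/sq ->]; rewrite orbT.
Qed.

Lemma walk_mono e e' A B p : subrel e e' -> walk e A B p -> walk e' A B p.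
Proof. by case: p => //= x p ee /and3P[-> /(sub_path ee) -> ->]. Qed.

Definition del_arc e x y : rel V := fun u v => e u v && ((u, v) != (x, y)).

(** Stop the walk when it is about to traverse [xy] for the first time: what precedes is a walk to
    [x] without this arc. *)
Lemma walk_del_first e x y A B p : walk e A B p ->
  walk (del_arc e x y) A B p \/
  [/\ x \in p & exists q, walk (del_arc e x y) A (pred1 x) q /\ {subset q <= p}].
Proof.
elim: p A => // v [|w p] IH A; first by left.
rewrite walk_cons => /and3P[Av evw /IH{IH}IH].
have [[ev ew]|ne] := (v, w) =P (x, y).
  right; rewrite -ev mem_head; split=> //.
  by exists [:: v]; rewrite /= Av eqxx; split=> // u; rewrite !inE => /eqP->; rewrite eqxx.
have dvw : del_arc e x y v w by rewrite /del_arc evw; apply/eqP.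
case: IH => [wp|[xp [q [wq sq]]]]; first by left; rewrite walk_cons Av dvw.
right; split; first by rewrite inE xp orbT.
case: q wq sq => // w' q wq sq; have ew : w' = w by case/and3P: wq => /eqP.
subst w'; exists [:: v, w & q]; rewrite walk_cons Av dvw; split=> //.
by move=> u; rewrite inE => /orP[/eqP->|/sq hu]; rewrite inE ?eqxx // hu orbT.
Qed.

(** Mirror image: start after the last traversal of [xy]. *)
Lemma walk_del_last e x y A B p : walk e A B p ->
  walk (del_arc e x y) A B p \/
  [/\ y \in p & exists q, walk (del_arc e x y) (pred1 y) B q /\ {subset q <= p}].
Proof.
elim: p A => // v [|w p] IH A; first by left.
rewrite walk_cons => /and3P[Av evw /IH{IH}[wp|[yp [q [wq sq]]]]]; last first.
  right; split; first by rewrite inE yp orbT.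
  by exists q; split=> // u /sq up; rewrite inE up orbT.
have [[ev ew]|ne] := (v, w) =P (x, y).
  right; subst w; rewrite !inE eqxx orbT; split=> //.
  by exists (y :: p); split=> // u; rewrite !inE => hu; rewrite hu orbT.
by left; rewrite walk_cons Av wp /del_arc evw /= andbT; apply/eqP.
Qed.

(** If some [z] separates [A] from [B] once [xy] is deleted, then in the smaller digraph no single
    vertex separates [A] from [{z, x}] or [{z, y}] from [B]. The induction hypothesis gives two
    disjoint walks on either side; they are glued at [z] and along [xy]. *)
Lemma menger2_step e x y A B :
  (forall A B, (forall z, exists2 p, walk (del_arc e x y) A B p & z \notin p) ->
     exists p q, [/\ walk (del_arc e x y) A B p, walk (del_arc e x y) A B q
                   & ~~ has (mem p) q]) ->
  e x y ->
  (forall z, exists2 p, walk e A B p & z \notin p) ->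
  exists p q, [/\ walk e A B p, walk e A B q & ~~ has (mem p) q].
Proof.
set e' := del_arc e x y => IH exy sep.
have sub: subrel e' e by move=> u v /andP[].
case: (classic (forall z, exists2 p, walk e' A B p & z \notin p)).
  by move=> /IH[p [q [wp wq dis]]]; exists p, q; split=> //; apply: walk_mono sub _.
move=> /not_all_ex_not[z noz].
have {}noz p : walk e' A B p -> z \in p.
  by move=> wp; apply/negPn/negP => zp; apply: noz; exists p.
have [r wr zr] := sep z.
(* [z] is neither end of [xy], because a walk missing that end would survive the deletion. *)
have zx : z != x.
  apply/eqP => ezx; case: (walk_del_first x y wr) => [/noz|[xr _]]; first exact/negP.
  by move: zr; rewrite ezx xr.
have zy : z != y.
  apply/eqP => ezy; case: (walk_del_last x y wr) => [/noz|[yr _]]; first exact/negP.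
  by move: zr; rewrite ezy yr.
(* A walk missing [v] either reaches [x] before its first use of [xy], or survives the deletion and
   meets [z]. *)
have [|p [q [wp wq dpq]]] := IH A (pred2 z x).
  move=> v; have [s ws vs] := sep v.
  case: (walk_del_first x y ws) => [ws'|[_ [t [wt st]]]]; last first.
    exists t; last by apply: contra vs => /st.
    by case: t wt {st} => //= c t /and3P[-> -> ->]; rewrite orbT.
  have /splitPr zs := noz _ ws'; case: zs ws' vs => s1 s2.
  rewrite walk_split => /andP[w1 _] vs; exists (rcons s1 z); last first.
    by move: vs; rewrite mem_cat mem_rcons !inE !negb_or => /and3P[-> -> _].
  by case: (s1) w1 => [|c t] /=; rewrite ?last_rcons ?eqxx ?andbT // => /andP[-> ->].
have [|p' [q' [wp' wq' dpq']]] := IH (pred2 z y) B.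
  move=> v; have [s ws vs] := sep v.
  case: (walk_del_last x y ws) => [ws'|[_ [t [wt st]]]]; last first.
    exists t; last by apply: contra vs => /st.
    by case: t wt {st} => //= c t /and3P[-> -> ->]; rewrite orbT.
  have /splitPr zs := noz _ ws'; case: zs ws' vs => s1 s2.
  rewrite walk_split => /andP[_ w1] vs; exists (z :: s2); last first.
    by move: vs; rewrite mem_cat !inE !negb_or => /andP[].
  by case/and3P: w1 => /= _ -> ->; rewrite eqxx.
(* At a common vertex [v] the two walks join to an [A]-[B] walk without [xy], which must pass [z].
   As [z] can only be the last vertex of [s1] and the first of [s2], simplicity leaves [v = z]. *)
have meet s1 s2 C1 C2 v : walk e' A C1 s1 -> walk e' C2 B s2 ->
    uniq s1 -> (z \in s1 -> last z s1 = z) -> uniq s2 -> (z \in s2 -> head z s2 = z) ->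
    v \in s1 -> v \in s2 -> v = z.
  move=> w1 w2 u1 z1 u2 z2 /splitPr vs1; case: vs1 w1 u1 z1 => a1 b1.
  rewrite walk_split => /andP[w1 _] u1 z1.
  move=> /splitPr vs2; case: vs2 w2 u2 z2 => a2 b2; rewrite walk_split => /andP[_ w2] u2 z2.
  have /noz : walk e' A B (a1 ++ v :: b2) by rewrite walk_split w1.
  rewrite mem_cat inE => /or3P[za|/eqP-> //|zb].
    move: z1; rewrite mem_cat za last_cat /= => /(_ isT) lz.
    move: u1; rewrite cat_uniq => /and3P[_ /hasPn hn _].
    by have := hn _ (mem_last v b1); rewrite /= lz za.
  move: z2 u2; rewrite mem_cat inE zb !orbT => /(_ isT).
  case: (a2) => [//|c a] /= ->.
  by rewrite mem_cat inE zb !orbT.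
(* Disjoint walks have different ends, so one ends at [z] and the other at [x]. *)
have {p q wp wq dpq} [p [q [wp wq up uq dpq]]] : exists p q, [/\ walk e' A (pred1 z) p,
    walk e' A (pred1 x) q, uniq p, uniq q & forall v, v \in p -> v \in q -> False].
  have [p0 [wp0 up0 sp]] := walk_uniq wp; have [q0 [wq0 uq0 sq]] := walk_uniq wq.
  have d v : v \in p0 -> v \in q0 -> False.
    by move=> /sp vp /sq vq; move/hasPn: dpq => /(_ _ vq); rewrite /= vp.
  have l t : walk e' A (pred2 z x) t -> [\/ walk e' A (pred1 z) t | walk e' A (pred1 x) t].
    by case: t => // c t /and3P[/= -> -> /orP[]->]; [left|right].
  have m c t : walk e' A (pred1 c) t -> c \in t.
    by case: t => // c' t /and3P[_ _ /eqP/=<-]; exact: mem_last.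
  case/l: (wp0) => [pz|px]; case/l: (wq0) => [qz|qx].
  - by case: (d z); apply: m.
  - by exists p0, q0.
  - by exists q0, p0; split=> // v vq vp; apply: (d v).
  - by case: (d x); apply: m.
have {p' q' wp' wq' dpq'} [p' [q' [wp' wq' up' uq' dpq']]] : exists p q,
    [/\ walk e' (pred1 z) B p, walk e' (pred1 y) B q, uniq p, uniq q &
       forall v, v \in p -> v \in q -> False].
  have [p0 [wp0 up0 sp]] := walk_uniq wp'; have [q0 [wq0 uq0 sq]] := walk_uniq wq'.
  have d v : v \in p0 -> v \in q0 -> False.
    by move=> /sp vp /sq vq; move/hasPn: dpq' => /(_ _ vq); rewrite /= vp.
  have l t : walk e' (pred2 z y) B t -> [\/ walk e' (pred1 z) B t | walk e' (pred1 y) B t].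
    by case: t => // c t /and3P[/= /orP[->|->] -> ->]; [left|right].
  have m c t : walk e' (pred1 c) B t -> c \in t.
    by case: t => // c' t /and3P[/eqP/= -> _ _]; exact: mem_head.
  case/l: (wp0) => [pz|px]; case/l: (wq0) => [qz|qx].
  - by case: (d z); apply: m.
  - by exists p0, q0.
  - by exists q0, p0; split=> // v vq vp; apply: (d v).
  - by case: (d y); apply: m.
have zp : z \in p by case: (p) wp => // c t /and3P[_ _ /eqP/=<-]; exact: mem_last.
have zp' : z \in p' by case: (p') wp' => // c t /and3P[/eqP/= -> _ _]; exact: mem_head.
have lp : last z p = z by case: (p) wp => // c t /and3P[_ _ /eqP].
have hp : head z p' = z by case: (p') wp' => // c t /and3P[/eqP].
have zq : z \notin q by apply/negP; exact: (dpq z).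
have zq' : z \notin q' by apply/negP; exact: (dpq' z).
have epp : exists p1, p = rcons p1 z by case/lastP: (p) zp lp => // p1 c _; rewrite last_rcons => ->; exists p1.
have epp' : exists p2, p' = z :: p2 by case: (p') zp' hp => // c p2 _ /= ->; exists p2.
case: epp epp' => p1 ep [p2 ep'].
exists (p1 ++ z :: p2), (q ++ q'); split.
- by rewrite walk_split (walk_mono sub) -?ep // (walk_mono sub) -?ep'.
- case: (q) wq => // c t /and3P[Ac pc /eqP/= lc].
  case: (q') wq' => // c' t' /and3P[/eqP/= -> pc' Bc'].
  by rewrite cat_path last_cat /= lc Ac Bc' exy !(sub_path sub).
- apply/hasPn=> v; rewrite mem_cat => vq; apply/negP => /= vp.
  have {}vp : v \in p \/ v \in p'.
    move: vp; rewrite ep ep' mem_cat mem_rcons !inE.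
    by case/or3P=> ->; rewrite ?orbT; [left|left|right].
  case: vp => vp; case/orP: vq => vq.
  + exact: dpq vp vq.
  + suff vz: v = z by move: zq'; rewrite -vz vq.
    by apply: (meet p q' _ _ v wp wq') => // h; move: zq'; rewrite h.
  + suff vz: v = z by move: zq; rewrite -vz vq.
    by apply: (meet q p' _ _ v wq wp') => // h; move: zq; rewrite h.
  + exact: dpq' vp vq.
Qed.

(* Goering's proof, by induction on the number of arcs.  On an empty type the
   hypothesis is void, hence [z0]. *)
Theorem menger2 e A B (z0 : V) :
  (forall z, exists2 p, walk e A B p & z \notin p) ->
  exists p q, [/\ walk e A B p, walk e A B q & ~~ has (mem p) q].
Proof.
have [n] := ubnP #|[pred a : V * V | e a.1 a.2]|; elim: n e A B => // n IH e A B lt sep.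
case: (pickP [pred a : V * V | e a.1 a.2]) => [[x y] /= exy|no].
  apply: (@menger2_step e x y A B) => // A' B' sep'; apply: IH => //.
  rewrite -ltnS; apply: leq_trans lt; rewrite ltnS.
  apply/proper_card/properP; split.
    by apply/subsetP=> -[u v] /andP[].
  by exists (x, y); rewrite !inE //= /del_arc eqxx andbF.
have one p : walk e A B p -> exists x, p = [:: x].
  case: p => // x [|y p]; first by exists x.
  by rewrite walk_cons => /and3P[_ exy]; have /= := no (x, y); rewrite exy.
have [p wp _] := sep z0; have [x ep] := one _ wp; have [q wq xq] := sep x.
have [y eq] := one _ wq; exists p, q; split=> //.
by move: xq; rewrite ep eq /= orbF !inE eq_sym.
Qed.
End Walks.

(** * Bridges and cuts *)

Section Order.
Variable V : finType.
Implicit Types (X : seq V) (u v w : V).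

Definition before X u v := [&& u \in X, v \in X & index u X < index v X].

Lemma before_split X u v : uniq X -> before X u v ->
  exists A B C, X = A ++ u :: B ++ v :: C.
Proof.
move=> uX /and3P[/splitPr uX' vX]; case: uX' uX vX => A B uX.
rewrite mem_cat index_cat [index u (u :: B)]/= eqxx addn0 index_cat.
case: ifP => uA; first by move: uX; rewrite cat_uniq /= uA /= andbF.
case: ifP => vA; first by move=> _; rewrite ltnNge index_size.
rewrite inE /= eq_sym; case: eqP => [_|_ /=]; first by rewrite addn0 ltnn.
by case/splitPr => B' C _; exists A, B', C.
Qed.

Lemma split_before A B C u v : uniq (A ++ u :: B ++ v :: C) ->
  before (A ++ u :: B ++ v :: C) u v.
Proof.
move=> uX; rewrite /before !(mem_cat, inE) !eqxx !orbT /=.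
move: uX; rewrite cat_uniq /= mem_cat inE !has_cat /= !negb_or.
case/and3P=> _ /and4P[uA _ vA _] /andP[/and3P[uB uv _] _].
by rewrite !index_cat /= eqxx (negPf uA) (negPf vA) (negPf uv) /=; lia.
Qed.

Lemma before_total X u v : u \in X -> v \in X -> [\/ before X u v, u = v | before X v u].
Proof.
move=> uX vX; rewrite /before uX vX /=.
case: (ltngtP (index u X) (index v X)) => // [| |h]; [by constructor 1|by constructor 3|].
by constructor 2; rewrite -(nth_index u uX) h nth_index.
Qed.

Lemma before_trans X u v w : before X u v -> before X v w -> before X u w.
Proof. by move=> /and3P[ux vx uv] /and3P[_ wx vw]; apply/and3P; split=> //; lia. Qed.

Lemma before_irr X u : before X u u = false.
Proof. by rewrite /before ltnn !andbF. Qed.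

Lemma beforeN X u v : before X u v -> before X v u -> False.
Proof. by move=> /and3P[_ _ uv] /and3P[_ _]; rewrite ltnNge (ltnW uv). Qed.

Lemma mem_between A u B w C v : uniq (A ++ u :: B ++ w :: C) ->
  before (A ++ u :: B ++ w :: C) u v -> before (A ++ u :: B ++ w :: C) v w -> v \in B.
Proof.
move=> uX uv vw; have : v \in A ++ u :: B ++ w :: C by case/and3P: uv.
rewrite mem_cat inE mem_cat inE => /orP[vA|/orP[/eqP evu|/orP[//|/orP[/eqP evw|vC]]]].
- case/splitPr: vA uX uv vw => A1 A2 + uv _; rewrite -catA /= => uX.
  by case: (beforeN uv); rewrite -catA; exact: split_before.
- by move: uv; rewrite evu before_irr.
- by move: vw; rewrite evw before_irr.
case/splitPr: vC uX uv vw => C1 C2 + _ vw; rewrite -cat_cons catA => uX.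
by case: (beforeN vw); rewrite -cat_cons catA; exact: split_before.
Qed.

Lemma before_prefix A x B u : uniq (A ++ x :: B) -> before (A ++ x :: B) u x -> u \in A.
Proof.
move=> uX ux; have := ux; case/and3P=> + _ _; rewrite mem_cat inE.
case/or3P=> // [/eqP eu|/splitPr uB]; first by move: ux; rewrite eu before_irr.
by case: uB uX ux => B1 B2 uX ux; case: (beforeN ux); exact: split_before.
Qed.

Lemma before_suffix A x B w : uniq (A ++ x :: B) -> before (A ++ x :: B) x w -> w \in B.
Proof.
move=> uX xw; have := xw; case/and3P=> _ + _; rewrite mem_cat inE.
case/or3P=> // [/splitPr wA|/eqP ew]; last by move: xw; rewrite ew before_irr.
case: wA uX xw => A1 A2; rewrite -catA /= => uX xw.
by case: (beforeN xw); exact: split_before.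
Qed.

End Order.

(** * Disjoint pairs of tracks: bypasses, bridges and essential vertices *)

Section Tracks.
Variables (V : finType) (e : rel V) (s1 s2 t1 t2 : V).
Implicit Types (X Y W J : seq V).

Let S := pred2 s1 s2.
Let T := pred2 t1 t2.

Definition off X Y v := v \notin X ++ Y.

Definition track_pair X Y := [/\ walk e S T X, walk e S T Y & uniq (X ++ Y)].

(** [W] lists the inner vertices of the bridge; being nonempty, it makes the length at least 2. It
    may repeat vertices. *)
Definition bridged := exists X Y W b c,
  [/\ track_pair X Y, b \in X, c \in Y & [/\ W != [::], path e b (rcons W c) & all (off X Y) W]].

(** The vertex [v] of [X] can be bypassed; an empty [J] is a bypass by a single arc. *)
Definition jumpable X Y v := exists g h J,
  [/\ before X g v, before X v h, path e g (rcons J h) & all (off X Y) J].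

(** The case [u = v] is allowed and says that a single vertex separates. *)
Definition cut u v := forall R, walk e S T R -> u \in R \/ v \in R.

Definition essential v := exists z, cut v z.

Lemma offC X Y : off X Y =1 off Y X.
Proof. by move=> v; rewrite /off !mem_cat orbC. Qed.

Lemma track_pairC X Y : track_pair X Y -> track_pair Y X.
Proof. by case=> wX wY u; split=> //; rewrite uniq_catC. Qed.

Lemma pair_disj X Y v : track_pair X Y -> v \in X -> v \in Y -> False.
Proof. by case=> _ _; rewrite cat_uniq => /and3P[_ /hasPn h _] vX /h; rewrite /= vX. Qed.

Lemma pair_uniq X Y : track_pair X Y -> uniq X.
Proof. by case=> _ _; rewrite cat_uniq => /and3P[]. Qed.

Lemma cutC u v : cut u v -> cut v u.
Proof. by move=> c R /c[]; [right|left]. Qed.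

Lemma walk_switch A g B A' h C J : walk e S T (A ++ g :: B) -> walk e S T (A' ++ h :: C) ->
  path e g (rcons J h) -> walk e S T (A ++ g :: J ++ h :: C).
Proof.
rewrite !walk_split => /andP[-> _] /andP[_ /= /and3P[_ pC TC]].
by rewrite rcons_path => /andP[pJ hJ]; rewrite eqxx cat_path last_cat /= pJ hJ pC TC.
Qed.

Lemma walk_mid A g B h C : walk e S T (A ++ g :: B ++ h :: C) -> path e g (rcons B h).
Proof.
rewrite walk_split => /andP[_ /= /and3P[_ + _]].
by rewrite cat_path rcons_path /= => /and3P[-> ->].
Qed.

(** Only the part from the first inner vertex on is shortened, so a nonempty interior stays nonempty
    and a bridge keeps length at least 2. *)
Lemma shorten_inner g J h : path e g (rcons J h) ->
  exists J', [/\ path e g (rcons J' h), uniq J', {subset J' <= J} & nilp J' = nilp J].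
Proof.
case: J => [|d J]; first by exists [::].
rewrite rcons_path /= => /andP[/andP[gd] /shortenP[J' pJ uJ sJ] lh].
exists (d :: J'); split=> //; first by rewrite rcons_path /= gd pJ.
by move=> v; rewrite !inE => /orP[->//|/sJ ->]; rewrite orbT.
Qed.

(** The bypass and the stretch [B] change places: with [X] rerouted along [J], made simple, the
    vertices of [B] are free for a bridge. *)
Lemma jump_pair A g B h C Y J : track_pair (A ++ g :: B ++ h :: C) Y ->
  path e g (rcons J h) -> all (off (A ++ g :: B ++ h :: C) Y) J ->
  exists J', track_pair (A ++ g :: J' ++ h :: C) Y /\ all (off (A ++ g :: J' ++ h :: C) Y) B.
Proof.
case=> wX wY uXY /shorten_inner[J' [pJ uJ sJ _]] oJ; exists J'; split; last first.
  apply/allP=> v vB; have vX : v \in A ++ g :: B ++ h :: C.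
    by rewrite mem_cat inE mem_cat vB !orbT.
  have pXY : track_pair (A ++ g :: B ++ h :: C) Y by split.
  rewrite /off mem_cat; apply/norP; split; last by apply/negP=> /(pair_disj pXY vX).
  have := pair_uniq pXY; rewrite -cat_rcons uniq_catCA cat_uniq => /and3P[_ /hasPn hn _].
  have nv : v \notin rcons A g ++ h :: C by apply/negP=> /hn; rewrite /= vB.
  apply: contra nv; rewrite -cat_rcons !mem_cat => /or3P[->|/sJ vJ|->]; rewrite ?orbT //.
  by move/allP: oJ => /(_ _ vJ); rewrite /off mem_cat vX.
split=> //.
  have eX : A ++ g :: B ++ h :: C = (A ++ g :: B) ++ h :: C by rewrite -catA.
  by apply: (@walk_switch A g (B ++ h :: C) (A ++ g :: B)); rewrite // -eX.
rewrite -cat_rcons -!catA uniq_catCA cat_uniq uJ /=.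
have sub : subseq (rcons A g ++ (h :: C) ++ Y) ((A ++ g :: B ++ h :: C) ++ Y).
  rewrite -cat_rcons -!catA cat_subseq // -[X in subseq X]cat0s cat_subseq //.
  exact: sub0seq.
rewrite (subseq_uniq sub uXY) andbT; apply/hasPn=> v /(mem_subseq sub) vXY.
by apply/negP => /sJ vJ; move/allP: oJ => /(_ _ vJ); rewrite /off vXY.
Qed.

Lemma mem_off X Y v W : all (off X Y) W -> v \in W -> v \notin X /\ v \notin Y.
Proof. by move/allP=> h /h; rewrite /off mem_cat => /norP. Qed.

Lemma jump_split X Y v : track_pair X Y -> jumpable X Y v ->
  exists A g B1 B2 h C J,
   [/\ X = A ++ g :: (B1 ++ v :: B2) ++ h :: C, path e g (rcons J h) & all (off X Y) J].
Proof.
move=> pXY [g [h [J [gv vh pJ oJ]]]].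
have uX := pair_uniq pXY.
have [A [B [C eX]]] := before_split uX (before_trans gv vh).
have vB : v \in B by apply: (@mem_between V A g B h C); rewrite -eX.
by case/splitPr: vB eX => B1 B2 eX; exists A, g, B1, B2, h, C, J.
Qed.

(** After the bypass of [x], the freed stretch from [g] to [x] followed by the arc [xy] is a
    bridge. *)
Lemma bridged_jump_tail X Y x y : track_pair X Y -> x \in X -> y \in Y -> e x y ->
  jumpable X Y x -> bridged.
Proof.
move=> pXY xX yY exy /(jump_split pXY)[A [g [B1 [B2 [h [C [J [eX pJ oJ]]]]]]]].
have pXY' := pXY; rewrite eX in oJ pXY'.
have [J' [pXJ oB]] := jump_pair pXY' pJ oJ.
exists (A ++ g :: J' ++ h :: C), Y, (rcons B1 x), g, y; split=> //.
  by rewrite mem_cat mem_head orbT.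
have wX : walk e S T X by case: pXY.
split; first by case: (B1).
- rewrite rcons_path last_rcons exy andbT.
  by apply: (@walk_mid A g B1 x (B2 ++ h :: C)); move: wX; rewrite eX -catA.
- by move: oB; rewrite -(cat_rcons x B1 B2) all_cat => /andP[].
Qed.

(** Mirror image: the arc [xy] and the freed stretch from [y] to [h] form the bridge. *)
Lemma bridged_jump_head X Y x y : track_pair X Y -> x \in X -> y \in Y -> e x y ->
  jumpable Y X y -> bridged.
Proof.
move=> pXY xX yY exy /(jump_split (track_pairC pXY))[A [g [B1 [B2 [h [C [J [eY pJ oJ]]]]]]]].
have pXY' := track_pairC pXY; rewrite eY in oJ pXY'.
have [J' [pXJ oB]] := jump_pair pXY' pJ oJ.
exists X, (A ++ g :: J' ++ h :: C), (y :: B2), x, h; split=> //.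
- exact: track_pairC.
- by rewrite mem_cat inE mem_cat mem_head !orbT.
have wY : walk e S T Y by case: pXY.
split=> //.
- rewrite rcons_cons /= exy /=.
  apply: (@walk_mid (A ++ g :: B1) y B2 h C); move: wY.
  by rewrite eY -!catA.
- by rewrite (eq_all (offC _ _)); move: oB; rewrite all_cat => /andP[].
Qed.

(** The tails are exchanged along the two crossing arcs, and the stretches between the ends of these
    arcs drop out of the tracks. *)
Lemma swap_tracks X Y x x' y y' : track_pair X Y -> before X x x' -> before Y y y' ->
  e x y' -> e y x' ->
  exists A B C A' B' C', [/\ X = A ++ x :: B ++ x' :: C, Y = A' ++ y :: B' ++ y' :: C',
    track_pair (A ++ [:: x, y' & C']) (A' ++ [:: y, x' & C]) &
    all (off (A ++ [:: x, y' & C']) (A' ++ [:: y, x' & C])) B].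
Proof.
move=> pXY xx yy xy' yx'.
have [A [B [C eX]]] := before_split (pair_uniq pXY) xx.
have [A' [B' [C' eY]]] := before_split (pair_uniq (track_pairC pXY)) yy.
exists A, B, C, A', B', C'; case: (pXY) => wX wY uXY.
have uBig : uniq ((A ++ [:: x, y' & C']) ++ (A' ++ [:: y, x' & C]) ++ B ++ B').
  move: uXY; rewrite eX eY; apply: etrans; apply: perm_uniq.
  apply/permP=> a; rewrite !count_cat /= !count_cat /=; lia.
split=> //; first split.
- move: wX wY; rewrite eX eY -[x :: B ++ _]cat_cons => wX wY.
  apply: (@walk_switch A x (B ++ x' :: C) (A' ++ y :: B') y' C' [::]) => //=; last by rewrite xy'.
  by rewrite -catA.
- move: wX wY; rewrite eX eY => wX wY.
  apply: (@walk_switch A' y (B' ++ y' :: C') (A ++ x :: B) x' C [::]) => //=; last by rewrite yx'.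
  by rewrite -catA.
- by move: uBig; rewrite catA cat_uniq => /andP[].
apply/allP=> v vB; rewrite /off; move: uBig; rewrite catA cat_uniq => /and3P[_ /hasPn h _].
by apply: h; rewrite mem_cat vB.
Qed.

(** After the exchange of tails, the old stretch of [X] from [x] to [x'] joins the two new tracks;
    it contains [z], so it is a bridge. *)
Lemma bridged_skip X Y x z x' y y' : track_pair X Y -> before X x z -> before X z x' ->
  before Y y y' -> e x y' -> e y x' -> bridged.
Proof.
move=> pXY xz zx yy xy' yx'.
have [A [B [C [A' [B' [C' [eX eY p oB]]]]]]] := swap_tracks pXY (before_trans xz zx) yy xy' yx'.
have zB : z \in B by apply: (@mem_between _ A x B x' C); rewrite -?eX //; exact: pair_uniq pXY.
exists (A ++ [:: x, y' & C']), (A' ++ [:: y, x' & C]), B, x, x'; split=> //.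
- by rewrite mem_cat mem_head orbT.
- by rewrite mem_cat !inE eqxx !orbT.
split=> //; first by case: (B) zB.
by case: pXY; rewrite eX => wX _ _; exact: walk_mid wX.
Qed.

(** Two disjoint tracks start at different vertices and so exhaust [S]. *)
Lemma pair_heads X Y x0 : track_pair X Y -> S =1 pred2 (head x0 X) (head x0 Y).
Proof.
case; case: X => // x X; case: Y => // y Y /and3P[/= Sx _ _] /and3P[Sy _ _].
rewrite mem_cat inE !negb_or => /andP[/and3P[_ xy _] _] v /=.
case/orP: Sx Sy xy => /eqP-> /orP[]/eqP->; rewrite ?eqxx //= => _.
by rewrite orbC.
Qed.

Lemma pair_lasts X Y x0 : track_pair X Y -> T =1 pred2 (last x0 X) (last x0 Y).
Proof.
case=> wX wY; case/lastP: X wX => // X x wX; case/lastP: Y wY => // Y y wY.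
have T_last Z z : walk e S T (rcons Z z) -> T z.
  by case: Z => [|a Z] /=; rewrite ?last_rcons => /andP[_] // /andP[].
have Tx := T_last _ _ wX; have Ty := T_last _ _ wY.
rewrite cat_uniq => /and3P[_ /hasPn/(_ y) + _]; rewrite mem_rcons mem_head => /(_ isT).
rewrite /= mem_rcons inE negb_or => /andP[xy _] v; rewrite !last_rcons /=.
case/orP: Tx Ty xy => /eqP-> /orP[]/eqP->; rewrite ?eqxx //= => _.
by rewrite orbC.
Qed.

Lemma before_last X x0 x : uniq X -> before X (last x0 X) x = false.
Proof.
move=> uX; apply/negP=> /and3P[lX xX]; case: X uX lX xX => // a X uX _ xX.
by rewrite [last _ _]/= index_last //; move: xX; rewrite -index_mem /=; lia.
Qed.

(** An [S]-[T] walk avoiding [x] and [y] starts before them on the tracks. To get beyond, it would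
    need a bypass of [x] or [y], a bridge, or a direct arc between the tracks, and each of these is
    excluded. *)
Lemma cut_at X Y x y : track_pair X Y -> ~ bridged -> x \in X -> y \in Y ->
  ~ jumpable X Y x -> ~ jumpable Y X y ->
  (forall u v, before X u x -> before Y y v -> ~~ e u v) ->
  (forall u v, before Y u y -> before X x v -> ~~ e u v) -> cut x y.
Proof.
move=> pXY nb xX yY nx ny xy yx R wR; apply/orP/negPn/negP => /norP[xR yR].
(* [left] collects the vertices before [x] or [y] on the tracks and those off the tracks reached
   from them without touching a track. Arcs whose heads are neither [x] nor [y] do not lead out of
   it. *)
pose src g := before X g x \/ before Y g y.
pose left v := src v \/ exists g J, [/\ src g, path e g (rcons J v) & all (off X Y) J] /\ off X Y v.
have step v v' : left v -> e v v' -> v' != x -> v' != y -> left v'.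
  move=> lv evv v'x v'y.
  have {lv evv} [g [J [sg pJ oJ]]] : exists g J, [/\ src g, path e g (rcons J v') & all (off X Y) J].
    case: lv => [sv|[g [J [[sg pJ oJ] ov]]]]; first by exists v, [::]; rewrite /= evv.
    exists g, (rcons J v); rewrite rcons_path pJ last_rcons evv; split=> //.
    by rewrite all_rcons ov.
  have [ov|] := boolP (off X Y v'); first by right; exists g, J.
  rewrite /off negbK mem_cat => /orP[vX|vY].
    case: (before_total vX xX) => [vx|evx|xv]; first by left; left.
      by rewrite evx eqxx in v'x.
    (* The walk enters [X] beyond [x]: coming from [X] it bypasses [x]; coming from [Y] it is a
       forbidden arc if [J] is empty and a bridge otherwise. *)
    case: sg => [gx|gy]; first by case: nx; exists g, v', J.
    case: J pJ oJ => [|d J] pJ oJ; first by move: pJ; rewrite /= andbT (negPf (yx _ _ gy xv)).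
    case: nb; exists Y, X, (d :: J), g, v'; split=> //; first exact: track_pairC.
      by case/and3P: gy.
    by split=> //; rewrite (eq_all (offC _ _)).
  case: (before_total vY yY) => [vy|evy|yv]; first by left; right.
    by rewrite evy eqxx in v'y.
  case: sg => [gx|gy]; last first.
    by case: ny; exists g, v', J; split=> //; rewrite (eq_all (offC _ _)).
  case: J pJ oJ => [|d J] pJ oJ; first by move: pJ; rewrite /= andbT (negPf (xy _ _ gx yv)).
  by case: nb; exists X, Y, (d :: J), g, v'; split=> //; case/and3P: gx.
case: R wR xR yR => // r R /and3P[Sr pR TR] xR yR.
have lr : left r.
  left; move: Sr; rewrite /src (pair_heads x pXY) /=.
  have rx : r != x by apply: contraNneq xR => ->; exact: mem_head.
  have ry : r != y by apply: contraNneq yR => ->; exact: mem_head.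
  case: (X) xX => // a X' xX; case: (Y) yY => // b Y' yY /= /orP[]/eqP er; rewrite er in rx ry *.
    by left; rewrite /before mem_head xX /= eqxx (negPf rx).
  by right; rewrite /before mem_head yY /= eqxx (negPf ry).
have lall : left (last r R).
  elim: R r lr xR yR pR {Sr TR} => //= v R IH r lr.
  rewrite !inE !negb_or => /and3P[_ xv xR] /and3P[_ yv yR] /andP[rv pR].
  apply: IH => //; rewrite ?inE ?negb_or ?xv ?yv //.
  by apply: (step r) => //; rewrite eq_sym.
have lX : last x X \in X by case: (X) xX => // a X' _; rewrite /= mem_last.
have lY : last x Y \in Y by case: (Y) yY => // a Y' _; rewrite /= mem_last.
(* The walk ends at the last vertex of a track, which is not in [left]. *)
move: TR; rewrite (pair_lasts x pXY) /= => /orP[]/eqP el; rewrite el in lall.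
  case: lall => [[|by']|[g [J [_]]]]; first by rewrite before_last // (pair_uniq pXY).
    by apply: (pair_disj pXY lX); case/and3P: by'.
  by rewrite /off mem_cat lX.
case: lall => [[bx|]|[g [J [_]]]]; last by rewrite /off mem_cat lY orbT.
  by apply: (pair_disj pXY) lY; case/and3P: bx.
by rewrite before_last // (pair_uniq (track_pairC pXY)).
Qed.

(** Take for [y] the last vertex of [Y] entered by an arc from before [x], or the first vertex of
    [Y] if there is no such arc. In the first case a bypass of the head [y] would yield a bridge; in
    the second nothing precedes [y]. *)
Lemma partner_ex X Y x : track_pair X Y -> ~ bridged -> x \in X ->
  exists y, [/\ y \in Y, ~ jumpable Y X y,
    forall u v, before X u x -> before Y y v -> ~~ e u v
    & (forall v, ~~ before Y v y) \/ exists u, before X u x /\ e u y].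
Proof.
move=> pXY nb xX; pose C v := (v \in Y) && [exists u, before X u x && e u v].
case: (pickP C) => [v0 Cv0|noC]; last first.
  have [y ey] : exists y, Y = y :: behead Y by case: pXY => _; case: (Y) => // y Y' _ _; exists y.
  have first v : ~~ before Y v y by rewrite /before ey /= eqxx ltn0 !andbF.
  exists y; split; [by rewrite ey mem_head| |move=> u v ux yv|by left].
    by case=> g [h [J [gy _ _ _]]]; move: (first g); rewrite gy.
  apply/negP => euv; move: (noC v); rewrite /C; case/and3P: yv => _ -> _ /=.
  by move/negbT/negP; apply; apply/existsP; exists u; rewrite ux.
case: (@arg_maxnP _ v0 C (index^~ Y) Cv0) => y /andP[yY /existsP[u /andP[ux uy]]] ymax.
exists y; split=> //; [|move=> u' v ux' yv|by right; exists u].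
  by move=> j; apply: nb; apply: (bridged_jump_head pXY _ yY uy j); case/and3P: ux.
apply/negP=> euv; have /ymax : C v.
  by rewrite /C; case/and3P: yv => _ -> _ /=; apply/existsP; exists u'; rewrite ux'.
by case/and3P: yv => _ _; lia.
Qed.

(** With the partner [y] of [x], an arc from before [y] to beyond [x] would cross the arc entering
    [y] and skip [x], giving a bridge; so [cut_at] applies. *)
Lemma unjumpable_essential X Y x : track_pair X Y -> ~ bridged -> x \in X ->
  ~ jumpable X Y x -> essential x.
Proof.
move=> pXY nb xX nx; have [y [yY ny ymax yfirst]] := partner_ex pXY nb xX.
exists y; apply: (cut_at pXY) => // u v uy xv; apply/negP => euv; apply: nb.
case: yfirst => [/(_ u)|[w [wx wy]]]; first by rewrite uy.
exact: bridged_skip pXY wx xv uy wy euv.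
Qed.

Lemma essential_pair X Y u z : track_pair X Y -> cut u z -> u \in X -> z \in Y.
Proof.
by move=> pXY c uX; case: (pXY) => _ /c[uY|//] _; case: (pair_disj pXY uX uY).
Qed.

Lemma essential_mem X Y u : track_pair X Y -> essential u -> (u \in X) || (u \in Y).
Proof.
move=> pXY [z c]; case: (pXY) => /c[->//|zX] /c[->|zY] _; rewrite ?orbT //.
by case: (pair_disj pXY zX zY).
Qed.

(** Bypassing [u] gives a pair whose first track misses [u] and would have to meet the cut in [z],
    which lies on [Y]. *)
Lemma essential_unjumpable X Y u : track_pair X Y -> essential u -> u \in X -> ~ jumpable X Y u.
Proof.
move=> pXY [z c] uX /(jump_split pXY)[A [g [B1 [B2 [h [C [J [eX pJ oJ]]]]]]]].
have zY := essential_pair pXY c uX.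
rewrite eX in oJ pXY; have [J' [pXJ oB]] := jump_pair pXY pJ oJ.
move/allP/(_ u): oB; rewrite mem_cat mem_head orbT => /(_ isT).
rewrite /off mem_cat => /norP[uX' _].
by case: (pXJ) => /c[|zX _ _]; [rewrite (negPf uX')|case: (pair_disj pXJ zX zY)].
Qed.

(** Let [y] be the partner of [x']. Unless [{x, y}] is a cut as well, some arc leads from before [y]
    to beyond [x] and crosses the arc entering [y]. The ends of both arcs on [X] cannot be bypassed,
    and skipping [x] or [x'] would give a bridge, so these ends are [x] and [x'] themselves. *)
Lemma consecutive_essential X Y x x' : track_pair X Y -> ~ bridged -> before X x x' ->
  ~ jumpable X Y x -> ~ jumpable X Y x' ->
  (forall m, before X x m -> before X m x' -> jumpable X Y m) ->
  (exists y, cut x y /\ cut x' y) \/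
  (exists l l', [/\ before Y l l', e x l' & e l x']).
Proof.
move=> pXY nb xx' nx nx' nom; have [xX x'X _] := and3P xx'.
have [y [yY ny ymax yfirst]] := partner_ex pXY nb x'X.
have cx' : cut x' y.
  apply: (cut_at pXY) => // u v uy xv; apply/negP => euv; apply: nb.
  case: yfirst => [/(_ u)|[w [wx wy]]]; first by rewrite uy.
  exact: bridged_skip pXY wx xv uy wy euv.
case: (classic (exists u v, [/\ before Y u y, before X x v & e u v])); last first.
  move=> noc; left; exists y; split=> //; apply: (cut_at pXY) => // u v.
    by move=> ux; apply: ymax; exact: before_trans ux xx'.
  by move=> uy xv; apply/negP => euv; apply: noc; exists u, v.
case=> u [v [uy xv euv]]; right.
case: yfirst => [/(_ u)|[w [wx' wy]]]; first by rewrite uy.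
have wX : w \in X by case/and3P: wx'.
have nw : ~ jumpable X Y w by move=> j; apply: nb; exact: bridged_jump_tail pXY wX yY wy j.
have vX : v \in X by case/and3P: xv.
have nv : ~ jumpable X Y v.
  move=> j; apply: nb; apply: (bridged_jump_head (track_pairC pXY) _ vX euv j).
  by case/and3P: uy.
have ewx : w = x.
  case: (before_total wX xX) => // [wx|xw]; last by case: nw; apply: nom.
  by case: nb; exact: bridged_skip pXY wx xv uy wy euv.
have evx' : v = x'.
  case: (before_total vX x'X) => // [vx'|x'v]; first by case: nv; apply: nom.
  by case: nb; exact: bridged_skip pXY wx' x'v uy wy euv.
by subst w v; exists u, y.
Qed.

(** Go from [u] to [w] through the consecutive vertices of [X] that cannot be bypassed. Neighbours
    with a common partner are related by [E]; crossing arcs between them would allow an exchange of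
    tails that puts [u] and [w] on different tracks. *)
Lemma same_side X Y u w (E : V -> V -> Prop) : track_pair X Y -> ~ bridged ->
  essential u -> essential w -> before X u w ->
  (forall x y z, E x y -> E y z -> E x z) ->
  (forall x y z, cut x z -> cut z y -> E x y) ->
  (forall X' Y', track_pair X' Y' -> u \in X' -> w \in Y' -> False) ->
  E u w.
Proof.
move=> pXY nb uU wU uw Etr EB sep.
have uX : u \in X by case/and3P: uw. have wX : w \in X by case/and3P: uw.
suff gen n x x' : index x' X - index x X < n -> before X x x' ->
    (x = u \/ before X u x) -> (x' = w \/ before X x' w) ->
    ~ jumpable X Y x -> ~ jumpable X Y x' -> E x x'.
  apply: (gen (index w X - index u X).+1) => //; [by left|by left| |].
    exact: essential_unjumpable.
  exact: essential_unjumpable.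
elim: n x x' => // n IH x x' lt xx' ux x'w nx nx'.
case: (classic (exists m, [/\ before X x m, before X m x' & ~ jumpable X Y m])).
  case=> m [xm mx' nm].
  have lt1 : index x X < index m X by case/and3P: xm.
  have lt2 : index m X < index x' X by case/and3P: mx'.
  apply: (Etr _ m).
    apply: IH => //; first by lia.
    by right; case: x'w => [<-//|]; apply: before_trans.
  apply: IH => //; first by lia.
  by right; case: ux => [<-//|ux]; apply: before_trans xm.
move=> nom; case: (consecutive_essential pXY nb xx' nx nx') => [m xm mx'|[y [c c']]|].
- by apply: NNPP => nm; apply: nom; exists m.
- by apply: EB c _; apply: cutC.
case=> l [l' [ll xl' lx']]; exfalso.
(* The exchange leaves [u], at or before [x], on the first track and moves [w], at or after [x'], to
   the second. *)
have [A [B [C [A' [B' [C' [eX eY p oB]]]]]]] := swap_tracks pXY xx' ll xl' lx'.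
have uXX : uniq (A ++ x :: B ++ x' :: C) by rewrite -eX; exact: pair_uniq pXY.
apply: (sep _ _ p).
  case: ux => [<-|ux]; first by rewrite mem_cat mem_head orbT.
  by move: ux; rewrite eX => /(before_prefix uXX) uA; rewrite mem_cat uA.
case: x'w => [<-|]; first by rewrite mem_cat !inE eqxx !orbT.
rewrite eX -cat_cons catA => /before_suffix; rewrite -catA => /(_ uXX) wC.
by rewrite mem_cat !inE wC !orbT.
Qed.

(** Cut the path down to a stretch without inner vertices on the tracks: an inner vertex on [X]
    becomes the new start, one on [Y] the new end. Such an end is not essential. The last hypothesis
    records this for the case of a single remaining arc, whose ends would both be essential if there
    were no bridge. *)
Lemma separated_bridged X Y g w I : track_pair X Y -> g \in X -> w \in Y ->
  path e g (rcons I w) -> (forall k, k \in I -> ~ essential k) ->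
  [\/ I != [::], ~ essential g | ~ essential w] -> bridged.
Proof.
move=> pXY; have [n] := ubnP (size I); elim: n I g w => // n IH I g w lt gX wY pI nI flag.
case: (boolP (has (mem X) I)) => [/hasP[k kI kX]|noX].
  have nk := nI _ kI; case/splitPr: kI lt pI nI flag => I1 I2 lt pI nI _.
  apply: (IH I2 k w) => //; last by constructor 2.
  - by move: lt; rewrite size_cat /=; lia.
  - by move: pI; rewrite rcons_cat cat_path /= => /and3P[].
  - by move=> v vI; apply: nI; rewrite mem_cat inE vI !orbT.
case: (boolP (has (mem Y) I)) => [/hasP[k kI kY]|noY].
  have nk := nI _ kI; case/splitPr: kI lt pI nI flag {noX} => I1 I2 lt pI nI _.
  apply: (IH I1 g k) => //; last by constructor 3.
  - by move: lt; rewrite size_cat /=; lia.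
  - by move: pI; rewrite rcons_cat cat_path [path e g (rcons I1 k)]rcons_path /= => /and3P[-> -> _].
  - by move=> v vI; apply: nI; rewrite mem_cat vI.
case: I {lt IH} pI nI flag noX noY => [|d I] pI nI flag noX noY; last first.
  exists X, Y, (d :: I), g, w; split=> //; split=> //.
  apply/allP=> v vI; rewrite /off mem_cat negb_or.
  by move/hasPn/(_ _ vI): noX => /= ->; move/hasPn/(_ _ vI): noY => /= ->.
apply: NNPP => nb; move: pI; rewrite /= andbT => egw.
have gE : essential g.
  apply: (unjumpable_essential pXY) => // j; apply: nb.
  exact: bridged_jump_tail pXY gX wY egw j.
have wE : essential w.
  apply: (unjumpable_essential (track_pairC pXY)) => // j; apply: nb.
  exact: bridged_jump_head pXY gX wY egw j.
by case: flag.
Qed.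

(** [E] stands for linkage by even walks of cuts. It is abstract, so that the table filled by the
    program can be substituted for it. *)
Theorem bridged_of_unlinked (E : V -> V -> Prop) u w I :
  (forall z, exists2 p, walk e S T p & z \notin p) ->
  (forall x y z, E x y -> E y z -> E x z) ->
  (forall x y z, cut x z -> cut z y -> E x y) ->
  essential u -> essential w -> ~ E u w ->
  path e u (rcons I w) -> I != [::] -> (forall k, k \in I -> ~ essential k) -> bridged.
Proof.
move=> sep Etr EB uE wE nE pI I0 nI; apply: NNPP => nb.
have [X [Y pXY]] : exists X Y, track_pair X Y.
  have [p [q [/walk_uniq[p' [wp up sp]] /walk_uniq[q' [wq uq sq]] d]]] := menger2 u sep.
  exists p', q'; split=> //; rewrite cat_uniq up uq andbT; apply/hasPn=> v /sq vq.
  by apply/negP=> /sp vp; move/hasPn: d => /(_ _ vq); rewrite /= vp.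
have apart X' Y' : track_pair X' Y' -> u \in X' -> w \in Y' -> False.
  move=> p uX wY; apply: nb; apply: (separated_bridged p uX wY pI nI).
  by constructor 1.
have same X' Y' : track_pair X' Y' -> u \in X' -> w \in X' -> False.
  move=> p uX wX; apply: nE; case: (before_total uX wX) => [uw|<-|wu].
  - exact: same_side p nb uE wE uw Etr EB apart.
  - by case: uE => z c; apply: EB c (cutC c).
  (* For the opposite order along the track, the converse of [E] has the same properties. *)
  - apply: (@same_side X' Y' w u (fun x y => E y x) p nb wE uE wu).
    + by move=> x y z xy yz; apply: Etr yz xy.
    + by move=> x y z xz zy; apply: (EB _ _ z); apply: cutC.
    + by move=> X1 Y1 p1 wX1 uY1; apply: (apart _ _ (track_pairC p1)).
case/orP: (essential_mem pXY uE) => uP; case/orP: (essential_mem pXY wE) => wP.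
- exact: same pXY uP wP.
- exact: apart pXY uP wP.
- exact: apart (track_pairC pXY) uP wP.
- exact: same (track_pairC pXY) uP wP.
Qed.

(** Restarting from any essential vertex of [p] shortens the path; the process ends at the last
    essential vertex before [d]. *)
Lemma last_essential x p d : path e x (rcons p d) -> essential x ->
  exists u I, [/\ u \in x :: p, essential u, path e u (rcons I d) &
                forall k, k \in I -> ~ essential k].
Proof.
have [n] := ubnP (size p); elim: n p x => // n IH p x lt px xE.
case: (classic (exists2 v, v \in p & essential v)) => [[v vp vE]|no]; last first.
  by exists x, p; split=> //; [exact: mem_head|move=> k kp kE; apply: no; exists k].
case/splitPr: vp lt px => p1 p2 lt; rewrite rcons_cat cat_path /= => /and3P[_ _ pv].
case: (IH p2 v _ pv vE) => [|u [I [uv uE pI nI]]]; first by move: lt; rewrite size_cat /=; lia.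
by exists u, I; split=> //; rewrite inE mem_cat uv !orbT.
Qed.

Lemma first_essential d p y : path e d (rcons p y) -> essential y ->
  exists w I, [/\ w \in rcons p y, essential w, path e d (rcons I w) &
                forall k, k \in I -> ~ essential k].
Proof.
have [n] := ubnP (size p); elim: n p y => // n IH p y lt py yE.
case: (classic (exists2 v, v \in p & essential v)) => [[v vp vE]|no]; last first.
  exists y, p; split=> //; first by rewrite mem_rcons mem_head.
  by move=> k kp kE; apply: no; exists k.
case/splitPr: vp lt py => p1 p2 lt; rewrite rcons_cat cat_path /= => /and3P[pv ev _].
have pv' : path e d (rcons p1 v) by rewrite rcons_path pv.
case: (IH p1 v _ pv' vE) => [|w [I [wv wE pI nI]]]; first by move: lt; rewrite size_cat /=; lia.
exists w, I; split=> //; rewrite mem_cat inE.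
by move: wv; rewrite mem_rcons inE => /orP[->|->]; rewrite ?orbT.
Qed.

(** A set [P] closed under two cut steps that contains [u] but not [w] certifies that no even walk
    of cuts links them. The vertex set of [X] is such a set, because every cut has one vertex on
    each track. *)
Theorem unlinked_of_bridged : bridged ->
  (forall z, exists2 p, walk e S T p & z \notin p) /\
  exists u w I (P : pred V),
    [/\ essential u, essential w, path e u (rcons I w) /\ I != [::],
        forall k, k \in I -> ~ essential k &
        [/\ P u, ~~ P w & forall x y z, cut x z -> cut z y -> P x -> P y]].
Proof.
case=> X [Y [W [b [c [pXY bX cY [W0 pW oW]]]]]]; have [wX wY uXY] := pXY; split.
  move=> z; case: (boolP (z \in X)) => zX; last by exists X.
  by exists Y => //; apply/negP => /(pair_disj pXY zX).
(* [{s1, s2}] and [{t1, t2}] are cuts, so both tracks start and end at essential vertices and the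
   searches for [u] and [w] succeed. *)
have sE : essential s1 /\ essential s2.
  by split; [exists s2|exists s1]; case=> // r R /and3P[/= /orP[]/eqP-> _ _];
     rewrite !inE eqxx; auto.
have tE : essential t1 /\ essential t2.
  by split; [exists t2|exists t1]; case=> // r R /and3P[/= _ _ /orP[]/eqP el];
     have := mem_last r R; rewrite el; auto.
have [d [W' eW]] : exists d W', W = d :: W' by case: (W) W0 => // d W' _; exists d, W'.
have [I1 [u [uX uE pI1 nI1]]] : exists I1 u, [/\ u \in X, essential u,
    path e u (rcons I1 d) & forall k, k \in I1 -> ~ essential k].
  case/splitPr: bX wX pXY uXY oW => X1 X2; rewrite walk_split => /andP[wb _] _ _ _.
  case: X1 wb => [|x X1] /= => [/andP[Sx _]|/and3P[Sx px _]].
    exists [::], b; split=> //; first exact: mem_head.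
      by case/orP: Sx => /eqP->; case: sE.
    by move: pW; rewrite eW /= => /andP[-> _].
  have xE : essential x by case/orP: Sx => /eqP->; case: sE.
  have pxd : path e x (rcons (rcons X1 b) d).
    by rewrite rcons_path px last_rcons; move: pW; rewrite eW /= => /andP[].
  have [u [I [uX uE pI nI]]] := last_essential pxd xE.
  exists I, u; split=> //; move: uX; rewrite !inE mem_rcons mem_cat !inE.
  by case/or3P=> ->; rewrite ?orbT.
have [I2 [w [wX' wE pI2 nI2]]] : exists I2 w, [/\ w \in Y, essential w,
    path e (last d W') (rcons I2 w) & forall k, k \in I2 -> ~ essential k].
  have dc : e (last d W') c by move: pW; rewrite eW /= rcons_path => /and3P[].
  case/splitPr: cY wY pXY uXY oW => Y1 Y2; rewrite walk_split => /andP[_ /and3P[_ pc Tc]] _ _ _.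
  have lE : essential (last c Y2) by case/orP: Tc => /eqP->; case: tE.
  have pl : path e (last d W') (rcons (belast c Y2) (last c Y2)) by rewrite -lastI /= dc.
  have [w [I [wY wE pI nI]]] := first_essential pl lE.
  exists I, w; split=> //; move: wY; rewrite -lastI mem_cat => ->; exact: orbT.
exists u, w, (I1 ++ W ++ I2), (mem X); split=> //.
- split; last by rewrite eW; case: (I1).
  move: pI1 pW; rewrite eW rcons_path !rcons_cat /= cat_path /= => /andP[-> ->].
  rewrite rcons_path => /and3P[_ pW' _].
  by rewrite cat_path pW' pI2.
(* The inner vertices of the bridge are off the tracks, while essential vertices lie on them. *)
- move=> k; rewrite !mem_cat => /or3P[/nI1//|kW|/nI2//] /(essential_mem pXY).
  by have [/negPf-> /negPf->] := mem_off oW kW.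
split=> //=; first by apply/negP => /(pair_disj pXY) /(_ wX').
move=> x y z xz zy xX; have zY := essential_pair pXY xz xX.
exact: essential_pair (track_pairC pXY) zy zY.
Qed.
End Tracks.

(** * Subdivisions *)

Section SubdivisionPaths.
Variables (U V : finType) (F : digraph U) (D : digraph V).

(** A subdivision without dependent types: [p a] lists the inner vertices of the path replacing the
    arc [a], and only its values on arcs are constrained. *)
Definition path_model (f : U -> V) (p : U * U -> seq V) :=
  [/\ injective f,
      forall a, arc_pred F a ->
        [/\ path (Defs.arc D) (f a.1) (rcons (p a) (f a.2)), uniq (p a) & forall z, f z \notin p a]
    & forall a b v, arc_pred F a -> arc_pred F b -> v \in p a -> v \in p b -> a = b].

Lemma subdivision_of_paths f p : path_model f p -> has_subdivision F D.
Proof.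
case=> injf pP disj; pose l (a : arc_type F) := size (p (val a)).
pose h (u : subdiv_vertex l) : V := match u with
  | inl x => f x
  | inr q => nth (f (val (tag q)).1) (p (val (tag q))) (tagged q)
  end.
have hin (q : {a : arc_type F & 'I_(l a)}) : h (inr q) \in p (val (tag q)).
  by rewrite /h mem_nth //; exact: ltn_ord.
exists l, h; split.
  case=> [x|q] [y|r] hxy.
  - by rewrite (injf _ _ hxy).
  - have [_ _ /(_ x)] := pP _ (valP (tag r)).
    by move: (hin r); rewrite -hxy /= => ->.
  - have [_ _ /(_ y)] := pP _ (valP (tag q)).
    by move: (hin q); rewrite hxy /= => ->.
  - have eqr : val (tag q) = val (tag r).
      by apply: (disj _ _ _ (valP (tag q)) (valP (tag r)) (hin q)); rewrite hxy.
    move/val_inj: eqr => eqr; congr inr; move: q r hxy eqr {hin} => [a i] [b j] /= hxy eab.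
    subst b; have [_ up _] := pP _ (valP a).
    congr existT; apply/val_inj/eqP; rewrite /= -(nth_uniq (f (val a).1) _ _ up) ?hxy //; exact: ltn_ord.
(* Consecutive entries along the path of [a], its two ends included, are joined by arcs; the four
   kinds of arcs of the subdivision are instances of this. *)
have nthP (a : arc_type F) i : i <= l a ->
    Defs.arc D (nth (f (val a).1) (f (val a).1 :: p (val a)) i)
          (nth (f (val a).1) (rcons (p (val a)) (f (val a).2)) i).
  move=> il; have [/(pathP (f (val a).1)) pa _ _] := pP _ (valP a).
  have := pa i; rewrite size_rcons ltnS => /(_ il); congr (Defs.arc D _ _).
  case: i il => //= i il; by rewrite nth_rcons il.
case=> [x|q] [y|r] /=.
- case/existsP=> a /andP[/eqP ea /eqP la]; have := nthP a 0 isT.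
  by rewrite nth_rcons -/(l a) la /= ea.
- case/andP=> /eqP-> /eqP r0; have := nthP (tag r) 0 isT.
  by rewrite /= nth_rcons r0 -{1}r0 ltn_ord.
- case/andP=> /eqP-> rl; have := nthP (tag q) (tagged q).+1 (ltn_ord _).
  by rewrite /= nth_rcons -/(l _) rl ltn_neqAle rl.
- case/andP=> /eqP; case: q r => [a i] [b j] /= eab; subst b => /eqP ij.
  have := nthP a i.+1 (ltn_ord i); rewrite /= nth_rcons ij.
  by rewrite -/(l a) ltn_ord.
Qed.

Lemma paths_of_subdivision : has_subdivision F D -> exists f p, path_model f p.
Proof.
case=> l [h [injh harc]]; pose f x := h (inl x).
pose q (a : arc_type F) := [seq h (inr (Tagged (fun a => 'I_(l a)) i)) | i <- enum 'I_(l a)].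
(* Pairs that are not arcs of [F] get the empty list. *)
pose p e := if insub e is Some a then q a else [::].
have pE (a : arc_type F) : p (val a) = q a by rewrite /p valK.
exists f, p; split.
- by move=> x y /injh[].
- move=> e Fe; have -> : e = val (Sub e Fe : arc_type F) by [].
  move: (Sub e Fe : arc_type F) => {e Fe} a; rewrite pE; split.
  + apply/(pathP (f (val a).1)) => i; rewrite size_rcons size_map size_enum_ord ltnS => il.
    have nq x0 j (jl : j < l a) : nth x0 (q a) j = h (inr (Tagged (fun a => 'I_(l a)) (Ordinal jl))).
      rewrite (nth_map (Ordinal jl)) ?size_enum_ord //; congr (h (inr (Tagged _ _))).
      by apply: val_inj; rewrite /= nth_enum_ord.
    have sq : size (q a) = l a by rewrite size_map size_enum_ord.
    rewrite nth_rcons sq; case: i il => [|i] il /=.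
      case: ifP => l0; first by rewrite nq; apply: harc; rewrite /= !eqxx.
      move/negbT: l0; rewrite -leqNgt leqn0 eq_sym => l0; rewrite l0.
      apply: harc; apply/existsP; exists a; rewrite -surjective_pairing eqxx /= eq_sym //.
    rewrite nth_rcons sq il (nq _ i il); case: ifP => il'; first by rewrite nq; apply: harc; rewrite /= !eqxx.
    have -> : i.+1 == l a by move/negbT: il'; lia.
    apply: harc; rewrite /= eqxx /=; move/negbT: il'; lia.
  + rewrite map_inj_uniq ?enum_uniq // => i j /injh[] /eqP; rewrite eq_Tagged => /eqP//.
  + by move=> z; apply/mapP=> -[i _ /injh].
- move=> a b v Fa Fb; have -> : a = val (Sub a Fa : arc_type F) by [].
  have -> : b = val (Sub b Fb : arc_type F) by [].
  by rewrite !pE => /mapP[i _ ->] /mapP[j _ /injh[]].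
Qed.
End SubdivisionPaths.

(** [D - a] on the same vertex type: [a] is isolated instead of removed. *)
Definition away V (D : digraph V) a : rel V :=
  fun x y => [&& Defs.arc D x y, x != a & y != a].

Lemma away_notin V (D : digraph V) a x p : x != a -> path (away D a) x p -> a \notin x :: p.
Proof.
elim: p x => [|y p IH] x xa /=; first by rewrite inE eq_sym xa.
by case/andP=> /and3P[_ _ ya] /(IH _ ya) h; rewrite inE negb_or eq_sym xa.
Qed.

Lemma mem_nth_flatten (T : eqType) (L : seq (seq T)) i v :
  v \in nth [::] L i -> v \in flatten L.
Proof.
move=> vi; apply/flattenP; exists (nth [::] L i) => //; apply: mem_nth.
by case: (leqP (size L) i) vi => // /(nth_default [::]) ->.
Qed.

Lemma nth_flatten_inj (T : eqType) (L : seq (seq T)) i j v : uniq (flatten L) ->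
  v \in nth [::] L i -> v \in nth [::] L j -> i = j.
Proof.
elim: L i j => [|s L IH] [|i] [|j] //=; rewrite ?nth_nil // cat_uniq => /and3P[us /hasPn d uL].
- by move=> vs /mem_nth_flatten/d; rewrite /= vs.
- by move=> /mem_nth_flatten/d vs; rewrite /= => vs'; move: vs; rewrite /= vs'.
- by move=> vi vj; rewrite (IH i j).
Qed.

Lemma uniq_flatten_map (S T : eqType) (p : S -> seq T) (s : seq S) : uniq s ->
  {in s, forall x, uniq (p x)} ->
  {in s &, forall x y v, v \in p x -> v \in p y -> x = y} ->
  uniq (flatten (map p s)).
Proof.
elim: s => //= x s IH /andP[xs us] up d; rewrite cat_uniq up ?mem_head //= andbC.
rewrite IH //=; last by move=> y z ys zs; apply: d; rewrite inE ?ys ?zs orbT.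
  apply/hasPn=> v /flatten_mapP[y ys vy]; apply/negP=> /= vx.
  by move: xs; rewrite (d x y _ _ v) ?mem_head ?inE ?ys ?orbT.
by move=> y ys; apply: up; rewrite inE ys orbT.
Qed.

(** * Subdivisions of [E9] as bridged pairs of tracks in [D - a] *)

Section E9.
Variables (V : finType) (D : digraph V).

Definition va : 'I_4 := @Ordinal 4 0 isT.
Definition vb : 'I_4 := @Ordinal 4 1 isT.
Definition vc : 'I_4 := @Ordinal 4 2 isT.
Definition vd : 'I_4 := @Ordinal 4 3 isT.

Lemma E9_cases (P : 'I_4 * 'I_4 -> Prop) :
  P (va, vb) -> P (vb, va) -> P (va, vc) -> P (vc, va) -> P (vb, vd) -> P (vd, vc) ->
  forall e, arc_pred E9 e -> P e.
Proof.
move=> pab pba pac pca pbd pdc [x y].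
have e0 (H : 0 < 4) : Ordinal H = va by apply: val_inj.
have e1 (H : 1 < 4) : Ordinal H = vb by apply: val_inj.
have e2 (H : 2 < 4) : Ordinal H = vc by apply: val_inj.
have e3 (H : 3 < 4) : Ordinal H = vd by apply: val_inj.
by case: x y => [[|[|[|[|x]]]] Hx] [[|[|[|[|y]]]] Hy] //= _; rewrite ?(e0, e1, e2, e3).
Qed.

(** Position of an arc in the order ab, ba, ac, ca, bd, dc, in which the inner paths are listed. *)
Definition E9_index (e : 'I_4 * 'I_4) : nat :=
  index (nat_of_ord e.1, nat_of_ord e.2) [:: (0, 1); (1, 0); (0, 2); (2, 0); (1, 3); (3, 2)].

(** The ends of the bridge become [b] and [c], its first inner vertex becomes [d], and each track,
    closed up through [a], gives the two paths replacing a 2-cycle. *)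
Lemma bridged_subdivision a s1 s2 t1 t2 :
  Defs.arc D a s1 -> Defs.arc D a s2 -> Defs.arc D t1 a -> Defs.arc D t2 a ->
  bridged (away D a) s1 s2 t1 t2 -> has_subdivision E9 D.
Proof.
move=> as1 as2 t1a t2a [X [Y [W0 [b [c [pXY bX cY [W0n pW0 oW0]]]]]]].
have [wX wY uXY] := pXY.
have [W [pW uW sW nW]] := shorten_inner pW0.
have oW v : v \in W -> v \notin X ++ Y by move/sW; move/allP: oW0 => h /h.
have sub : subrel (away D a) (Defs.arc D) by move=> x y /and3P[].
have arc_na x y : Defs.arc D x y -> x != y.
  by apply: contraTneq => ->; rewrite arc_irr.
have aX Z : walk (away D a) (pred2 s1 s2) (pred2 t1 t2) Z -> a \notin Z.
  case: Z => // z Z /and3P[sz pz _]; apply: away_notin pz.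
  by case/orP: sz => /eqP->; rewrite eq_sym; exact: arc_na.
have cX Z : walk (away D a) (pred2 s1 s2) (pred2 t1 t2) Z -> path (Defs.arc D) a (rcons Z a).
  case: Z => // z Z /and3P[sz /(sub_path sub) pz tz].
  rewrite /= rcons_path pz /=; apply/andP; split.
    by case/orP: sz => /eqP->.
  by case/orP: tz => /eqP->.
have aW : a \notin W.
  have ba : b != a by apply: contraNneq (aX _ wX) => <-.
  by have := away_notin ba pW; rewrite inE mem_rcons inE !negb_or => /and3P[].
case: W uW pW nW oW aW {sW} => [|d W] uW pW nW oW aW.
  by move: nW; case: (W0) W0n.
have := aX _ wX; have := aX _ wY; have := cX _ wX; have := cX _ wY.
case/splitPr: bX uXY {wX wY pXY oW0} oW => X1 X2; case/splitPr: cY => Y1 Y2.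
rewrite !rcons_cat !cat_path /= => uXY oW /and3P[pY1 Y1c pY2] /and3P[pX1 X1b pX2] aY aX'.
(* The empty list belongs to the arc from [b] to [d], since [d] directly follows [b] on the
   bridge. *)
pose L := [:: X1; X2; Y1; Y2; [::]; W].
have uL : uniq ([:: a; b; c; d] ++ flatten L).
  suff : uniq (a :: ((X1 ++ b :: X2) ++ Y1 ++ c :: Y2) ++ d :: W).
    apply: etrans; apply: perm_uniq; apply/permP=> P.
    rewrite /L /= !(count_cat, cats0) /= ?count_cat.
    move: (P a : nat) (P b : nat) (P c : nat) (P d : nat) => ka kb kc kd.
    move: (count P X1) (count P X2) (count P Y1) (count P Y2) (count P W) => *.
    clear; lia.
  rewrite cons_uniq cat_uniq uXY uW andbT; apply/andP; split.
    by rewrite mem_cat mem_cat (negPf aX') (negPf aY) (negPf aW).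
  by apply/hasPn=> v vW; exact: oW.
move: (uL); rewrite cat_uniq => /and3P[uV /hasPn dL uF].
pose f (i : 'I_4) := nth a [:: a; b; c; d] i.
apply: (@subdivision_of_paths _ _ E9 D f (fun e => nth [::] L (E9_index e))); split.
- by move=> i j /eqP; rewrite /f nth_uniq ?ltn_ord // => /eqP/val_inj.
- move=> e Ee; split; last first.
  + by move=> z; apply/negP=> /mem_nth_flatten/dL; rewrite /f mem_nth ?ltn_ord.
  + move: uF; elim: (L) (E9_index e) => [|s L' IH] [|i] //=; rewrite cat_uniq => /and3P[] // _ _.
    exact: IH.
  + have := sub_path sub pW; rewrite /= => /andP[bd pdc].
    move: e Ee; apply: E9_cases => //=; rewrite ?rcons_path ?pX1 ?pX2 ?pY1 ?pY2 //.
    by rewrite /= andbT.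
- move=> e e' v Ee Ee' ve ve'; have := nth_flatten_inj uF ve ve'.
  by move: e Ee e' Ee' {ve ve'}; apply: E9_cases; apply: E9_cases.
Qed.

Lemma subdivision_bridged : has_subdivision E9 D -> exists a s1 s2 t1 t2,
  [/\ Defs.arc D a s1, Defs.arc D a s2, Defs.arc D t1 a, Defs.arc D t2 a &
      bridged (away D a) s1 s2 t1 t2].
Proof.
case/paths_of_subdivision => f [p [injf pP disj]].
pose a := f va; pose b := f vb; pose c := f vc; pose d := f vd.
pose ab := p (va, vb); pose ba := p (vb, va); pose ac := p (va, vc).
pose ca := p (vc, va); pose bd := p (vb, vd); pose dc := p (vd, vc).
have [[Pab uab nab] [Pba uba nba] [Pac uac nac]] := And3 (pP (va, vb) isT) (pP (vb, va) isT) (pP (va, vc) isT).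
have [[Pca uca nca] [Pbd ubd nbd] [Pdc udc ndc]] := And3 (pP (vc, va) isT) (pP (vb, vd) isT) (pP (vd, vc) isT).
have fne i j : i != j -> (f i == f j) = false by move=> ij; apply: contraNF ij => /eqP/injf->.
have dj e e' v : arc_pred E9 e -> arc_pred E9 e' -> e != e' -> v \in p e -> (v \in p e') = false.
  by move=> Ee Ee' ne ve; apply: contraNF ne => ve'; apply/eqP; exact: disj ve ve'.
have away_path x q : a \notin x :: q -> path (Defs.arc D) x q -> path (away D a) x q.
  elim: q x => //= y q IH x; rewrite !inE !negb_or => /and3P[ax ay aq] /andP[xy pq].
  by rewrite /away xy eq_sym ax eq_sym ay IH // inE negb_or ay.
(* If a path between [a] and [b] or [c] is a single arc, its inner list is empty and the neighbour
   of [a] is the branch vertex itself; hence the defaults. *)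
exists a, (head b ab), (head c ac), (last b ba), (last c ca); split.
- by move: Pab; rewrite -/ab; case: (ab) => [|x q] /= /andP[].
- by move: Pac; rewrite -/ac; case: (ac) => [|x q] /= /andP[].
- by move: Pba; rewrite rcons_path => /andP[].
- by move: Pca; rewrite rcons_path => /andP[].
have aX : a \notin ab ++ b :: ba.
  by rewrite mem_cat inE !negb_or nab nba fne.
have aY : a \notin ac ++ c :: ca.
  by rewrite mem_cat inE !negb_or nac nca fne.
have aW : a \notin b :: rcons (bd ++ d :: dc) c.
  by rewrite inE mem_rcons inE mem_cat inE !negb_or nbd ndc !fne.
have wX : walk (away D a) (pred2 (head b ab) (head c ac)) (pred2 (last b ba) (last c ca)) (ab ++ b :: ba).
  have pX : path (Defs.arc D) a (ab ++ b :: ba).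
    by rewrite -cat_rcons cat_path Pab last_rcons; move: Pba; rewrite rcons_path => /andP[].
  move: pX aX; case: (ab) => [|x q] /= /andP[_ pX] aX; rewrite eqxx /= ?last_cat /= ?eqxx ?orbT ?andbT ?away_path //.
have wY : walk (away D a) (pred2 (head b ab) (head c ac)) (pred2 (last b ba) (last c ca)) (ac ++ c :: ca).
  have pY : path (Defs.arc D) a (ac ++ c :: ca).
    by rewrite -cat_rcons cat_path Pac last_rcons; move: Pca; rewrite rcons_path => /andP[].
  move: pY aY; case: (ac) => [|x q] /= /andP[_ pY] aY; rewrite eqxx /= ?last_cat /= ?eqxx ?orbT ?andbT ?away_path //.
have uall : uniq ((ab ++ b :: ba) ++ (ac ++ c :: ca) ++ (bd ++ d :: dc)).
  pose arcs := [:: (va, vb); (vb, va); (va, vc); (vc, va); (vb, vd); (vd, vc)].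
  have Earcs e : e \in arcs -> arc_pred E9 e.
    by rewrite !inE => /or4P[|||/or3P[||]] /eqP->.
  suff : uniq ([:: b; c; d] ++ flatten (map p arcs)).
    apply: etrans; apply: perm_uniq; apply/permP=> P.
    rewrite /arcs /= !(count_cat, cats0) /= ?count_cat /= -/ab -/ba -/ac -/ca -/bd -/dc.
    move: (P b : nat) (P c : nat) (P d : nat) => kb kc kd.
    move: (count P ab) (count P ba) (count P ac) (count P ca) (count P bd) (count P dc) => *.
    clear; lia.
  rewrite cat_uniq; apply/and3P; split; first by rewrite /= !inE !fne.
    apply/hasPn=> v /flatten_mapP[e /Earcs/pP[_ _ ne] ve]; apply/negP=> /= vV.
    by move: vV; rewrite !inE => /or3P[]/eqP ev; move: ve; rewrite ev (negPf (ne _)).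
  apply: uniq_flatten_map => // [e /Earcs/pP[]//|e e' /Earcs Ee /Earcs Ee' v].
  exact: disj.
have uXY : uniq ((ab ++ b :: ba) ++ ac ++ c :: ca).
  by move: uall; rewrite catA cat_uniq => /andP[].
exists (ab ++ b :: ba), (ac ++ c :: ca), (bd ++ d :: dc), b, c; split; [by []| | |split].
- by rewrite mem_cat mem_head orbT.
- by rewrite mem_cat mem_head orbT.
- by case: (bd).
- apply: away_path aW _; rewrite rcons_cat -cat_rcons cat_path Pbd last_rcons.
  exact: Pdc.
- apply/allP=> v vW; move: uall; rewrite catA cat_uniq => /and3P[_ /hasPn h _].
  exact: h.
Qed.
End E9.

(** * Marking programs *)

(* The radix used is N = n + 1, so that the digit 0 is legal even if n = 0. *)
Definition code N j ds := foldl (fun c d => c * N + d) j ds.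

(** Remainder and quotient by [N] recover the last digit and the rest; the leading part [j] may be
    any number. *)
Lemma code_inj N j ds j' ds' : size ds = size ds' -> all (ltn^~ N) ds -> all (ltn^~ N) ds' ->
  code N j ds = code N j' ds' -> (j, ds) = (j', ds').
Proof.
elim/last_ind: ds ds' => [|ds d IH] ds'; first by case: ds' => //= _ _ _ ->.
case/lastP: ds' => [|ds' d']; first by rewrite size_rcons.
rewrite !size_rcons !all_rcons /code !foldl_rcons => -[sz] /andP[dN aN] /andP[dN' aN'] e.
have N0 : 0 < N by apply: leq_ltn_trans dN.
have ed : d = d'.
  by have := congr1 (modn^~ N) e; rewrite /= !modnMDl !modn_small.
have ec : code N j ds = code N j' ds'.
  by move/eqP: e; rewrite ed eqn_add2r eqn_pmul2r // => /eqP.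
by case: (IH _ sz aN aN' ec) => -> ->; rewrite ed.
Qed.

Lemma code_bound N j ds : all (ltn^~ N) ds -> code N j ds < j.+1 * N ^ size ds.
Proof.
elim/last_ind: ds => [|ds d IH]; first by rewrite /= muln1.
rewrite all_rcons /code foldl_rcons size_rcons expnSr mulnA => /andP[dN /IH lt].
rewrite -/(code N j ds); apply: leq_trans (_ : (code N j ds).+1 * N <= _).
  by rewrite mulSn /=; move: (code N j ds * N) dN => x /=; lia.
by rewrite leq_mul2r lt orbT.
Qed.

(** The language of loop guards. Loop variables are given by their indices, and [BMark j l] looks up
    array [j] at the tuple of the variables listed in [l]. *)
Inductive bexp :=
| BEq of nat & nat
| BMark of nat & seq nat
| BNot of bexp
| BAnd of bexp & bexp.

Definition marks := nat -> seq nat -> bool.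

Fixpoint bsem (v : seq nat) (M : marks) b : bool :=
  match b with
  | BEq i j => nth 0 v i == nth 0 v j
  | BMark j l => M j [seq nth 0 v i | i <- l]
  | BNot b1 => ~~ bsem v M b1
  | BAnd b1 b2 => bsem v M b1 && bsem v M b2
  end.

Definition set_mark (M : marks) j ds : marks :=
  fun j' ds' => M j' ds' || (j' == j) && (ds' == ds).

(** Horner's scheme for [code] in the radix held in register 3, with the array number [j] as leading
    part. *)
Definition cell j (es : seq expr) :=
  Add (Reg 2) (foldl (fun e e' => Add (Mul e (Reg 3)) e') (Const j) es).

Definition var i := Reg (10 + i).

(** Truth values are 0 and 1. With truncated subtraction, [(x - y) + (y - x)] is the distance of [x]
    and [y], and 1 minus it is 1 exactly if they are equal. *)
Fixpoint compile b : expr :=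
  match b with
  | BEq i j => Defs.Sub (Const 1) (Add (Defs.Sub (var i) (var j)) (Defs.Sub (var j) (var i)))
  | BMark j l => Defs.Mem (cell j (map var l))
  | BNot b1 => Defs.Sub (Const 1) (compile b1)
  | BAnd b1 b2 => Mul (compile b1) (compile b2)
  end.

Lemma eval_cell s j es :
  eval s (cell j es) = reg s 2 + code (reg s 3) j (map (eval s) es).
Proof.
congr (_ + _); rewrite -[in RHS]/(eval s (Const j)); move: (Const j) => e.
by elim: es e => //= e' es IH e; rewrite IH.
Qed.

(** Seven digits hold the five guessed vertices and a pair; shorter indices are padded with 0. The
    eighth variable serves as intermediate vertex or witness. *)
Definition narrays := 7.
Definition nvars := 8.
Definition ndigits := 7.

Fixpoint well_formed b :=
  match b with
  | BEq i j => (i <= nvars) && (j <= nvars)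
  | BMark j l => [&& j < narrays, size l == ndigits & all (leq^~ nvars) l]
  | BNot b1 => well_formed b1
  | BAnd b1 b2 => well_formed b1 && well_formed b2
  end.

(** * Loop nests on the random-access machine: correctness and cost *)

Section Machine.
Variables (n m W : nat) (input : nat -> nat).

Definition base := 2 + (m + m).

(* Registers: 0 for the answer, 1 for n, 2 for the address of the first cell, 3
   for the radix, 4 for m, and 10, ..., 17 for the loop variables.  Register 18
   is never written: it supplies the digit 0 of unused positions. *)
Definition good (M : marks) (s : state) :=
  [/\ [/\ reg s 1 = n, reg s 2 = base, reg s 3 = n.+1, reg s 4 = m & reg s 18 = 0],
      forall a, a < base -> Defs.mem s a = input a
    & forall j ds, j < narrays -> size ds = ndigits -> all (ltn^~ n.+1) ds ->
        Defs.mem s (base + code n.+1 j ds) = M j ds].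

Definition has_vars s v := forall i, i < nvars -> reg s (10 + i) = nth 0 v i.

(** The index [nvars] denotes the constant digit 0, by register 18 on the machine and by the default
    of [nth] in the semantics. *)
Lemma var_val M s v i : good M s -> has_vars s v -> size v = nvars -> i <= nvars ->
  reg s (10 + i) = nth 0 v i.
Proof.
case=> [[_ _ _ _ r18] _ _] hv sv; rewrite leq_eqVlt => /orP[/eqP->|/hv//].
by rewrite r18 nth_default ?sv.
Qed.

Lemma digits_small v l : all (ltn^~ n) v -> all (ltn^~ n.+1) [seq nth 0 v i | i <- l].
Proof.
move=> av; apply/allP=> _ /mapP[i _ ->]; case: (ltnP i (size v)) => iv.
  by rewrite /= ltnS ltnW //; apply: (allP av); exact: mem_nth.
by rewrite nth_default.
Qed.

Lemma eval_cell_vars M s v j l : good M s -> has_vars s v -> size v = nvars ->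
  all (leq^~ nvars) l ->
  eval s (cell j (map var l)) = base + code n.+1 j [seq nth 0 v i | i <- l].
Proof.
move=> g hv sv al; rewrite eval_cell; case: (g) => [[_ -> -> _ _] _ _].
congr (_ + code _ _ _); rewrite -map_comp; apply/eq_in_map => i /(allP al) il /=.
exact: var_val g hv sv il.
Qed.

Lemma eval_compile M s v b : good M s -> has_vars s v -> size v = nvars ->
  all (ltn^~ n) v -> well_formed b -> eval s (compile b) = bsem v M b.
Proof.
move=> g hv sv av; elim: b => [i j|j l|b IH|b IHb c IHc] wf.
- case/andP: wf => il jl; have -> : eval s (compile (BEq i j)) =
    1 - ((reg s (10 + i) - reg s (10 + j)) + (reg s (10 + j) - reg s (10 + i))) by [].
  rewrite (var_val g hv sv il) (var_val g hv sv jl) /=.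
  by move: (nth 0 v i) (nth 0 v j) => x y; case: (x =P y) => /=; lia.
- case/and3P: wf => jl /eqP sl al; have ec := eval_cell_vars j g hv sv al.
  rewrite -[LHS]/(Defs.mem s (eval s (cell j (map var l)))) ec.
  by case: g => _ _ -> //; [rewrite size_map|exact: digits_small].
- by rewrite /= IH //; case: (bsem _ _ _).
- by case/andP: wf => wb wc; rewrite /= IHb // IHc //; case: (bsem _ _ b); case: (bsem _ _ c).
Qed.

Lemma good_set_reg M s r x : good M s -> 10 <= r < 18 -> good M (set_reg s r x).
Proof.
case=> [[r1 r2 r3 r4 r18] i c] lr; split=> //=.
by case: eqP => e1; case: eqP => e2; case: eqP => e3; case: eqP => e4; case: eqP => e5; split=> //; lia.
Qed.

(** Different entries have different codes, so the store changes one mark only and leaves the input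
    alone. *)
Lemma good_set_mark M s j ds : good M s -> j < narrays -> size ds = ndigits ->
  all (ltn^~ n.+1) ds -> good (set_mark M j ds) (set_mem s (base + code n.+1 j ds) 1).
Proof.
case=> rs i c lj sd ad; split=> //.
  by move=> a la /=; rewrite ltn_eqF ?i // (leq_trans la) // leq_addr.
move=> j' ds' lj' sd' ad'; rewrite [LHS]/= eqn_add2l /set_mark.
case: eqP => [ec|ne].
  by have [-> ->] := code_inj (etrans sd' (esym sd)) ad' ad ec; rewrite !eqxx orbT.
rewrite c //; case: (j' =P j) => [ej|]; last by rewrite orbF.
by case: (ds' =P ds) => [ed|]; rewrite ?orbF //; case: ne; rewrite ej ed.
Qed.

(** [d] nested loops over the variables from [i] on; the truncated difference of [n] and a variable
    is nonzero as long as the variable is below [n]. *)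
Fixpoint fors i d body :=
  if d is d'.+1 then
    Seq (Assign (10 + i) (Const 0))
        (While (Defs.Sub (Reg 1) (var i))
           (Seq (fors i.+1 d' body) (Assign (10 + i) (Add (var i) (Const 1)))))
  else body.

Fixpoint tuples d : seq (seq nat) :=
  if d is d'.+1 then flatten [seq map (cons x) (tuples d') | x <- iota 0 n] else [:: [::]].

(** Initialisation costs 2, every test 4 and every increment 4; the constant 6 includes the final
    test. *)
Fixpoint loop_cost B d := if d is d'.+1 then 6 + n * (8 + loop_cost B d') else B.

(** Each level adds [6 + 8 * n], which is at most [14 * n] for positive [n]. *)
Lemma loop_cost_bound B d : 0 < n -> loop_cost B d <= (B + 14 * d) * n ^ d.
Proof.
move=> n0; elim: d => [|d IH] /=; first by rewrite muln0 addn0 muln1.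
have p0 : 0 < n ^ d by rewrite expn_gt0 n0.
rewrite expnS; move: (n ^ d) (loop_cost B d) p0 IH => p c p0 IH.
have h1 : n * c <= n * ((B + 14 * d) * p) by rewrite leq_mul2l IH orbT.
have h2 : n <= n * p by rewrite leq_pmulr.
by rewrite mulnDr mulnCA; nia.
Qed.

(** [step] is the effect of the body on the marks, and [pre] holds the values of the outer
    variables. The last clause, that these are preserved, is what the enclosing loop needs in order
    to count on. *)
Lemma fors_spec body B (step : seq nat -> marks -> marks) :
  n < W ->
  (forall v M s, size v = nvars -> all (ltn^~ n) v -> good M s -> has_vars s v ->
     exists t s', [/\ exec W body s t s', t <= B, good (step v M) s' & reg s' = reg s]) ->
  forall d i pre M s, i + d = nvars -> size pre = i -> all (ltn^~ n) pre -> good M s ->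
    (forall k, k < i -> reg s (10 + k) = nth 0 pre k) ->
  exists t s', [/\ exec W (fors i d body) s t s', t <= loop_cost B d,
    good (foldl (fun M v => step (pre ++ v) M) M (tuples d)) s'
    & forall k, k < i -> reg s' (10 + k) = reg s (10 + k)].
Proof.
move=> nW bodyP; elim=> [|d IH] i pre M s id sp ap g hp.
  rewrite addn0 in id; have [||t [s' [ex tB g' er]]] := bodyP pre M s _ ap g.
  - by rewrite sp.
  - by move=> k kn; apply: hp; rewrite id.
  exists t, s'; split=> //; first by rewrite /= cats0.
  by move=> k _; rewrite er.
pose loop := While (Defs.Sub (Reg 1) (var i))
  (Seq (fors i.+1 d body) (Assign (10 + i) (Add (var i) (Const 1)))).
have ri : 10 <= 10 + i < 18 by move: id; rewrite /nvars; lia.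
(* Induction on the number [k] of iterations left, while variable [i] holds [x]. *)
have iter k : forall x M s, x + k = n -> good M s -> reg s (10 + i) = x ->
    (forall k, k < i -> reg s (10 + k) = nth 0 pre k) ->
    exists t s', [/\ exec W loop s t s', t <= 4 + k * (8 + loop_cost B d),
      good (foldl (fun M v => step (pre ++ v) M) M
              (flatten [seq map (cons y) (tuples d) | y <- iota x k])) s'
      & forall k, k < i -> reg s' (10 + k) = reg s (10 + k)].
  elim: k => [|k IHk] {M s g hp} x M s xk g hx hp.
    exists 4, s; split=> //; rewrite -[4]/((cost (Defs.Sub (Reg 1) (var i))).+1).
    apply: exec_WhileFalse; rewrite /= -/(10 + i) hx.
    by case: g => [[-> _ _ _ _] _ _]; rewrite -xk addn0 subnn.
  have [||||t1 [s1 [ex1 t1B g1 r1]]] := IH i.+1 (rcons pre x) M s _ _ _ g.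
  - by rewrite addSnnS.
  - by rewrite size_rcons sp.
  - by rewrite all_rcons ap andbT /= -xk; lia.
  - move=> k'; rewrite nth_rcons sp ltnS leq_eqVlt => /orP[/eqP->|k'i].
      by rewrite ltnn eqxx.
    by rewrite k'i; exact: hp.
  have hx1 : reg s1 (10 + i) = x by rewrite r1.
  have [|||t2 [s2 [ex2 t2B g2 r2]]] := IHk x.+1 _ (set_reg s1 (10 + i) x.+1) _ (good_set_reg _ g1 ri).
  - by rewrite addSnnS.
  - by rewrite /= eqxx.
  - by move=> k' k'i; rewrite /= eqn_add2l ltn_eqF // r1 ?hp //; exact: ltnW.
  exists (4 + (t1 + 4) + t2), s2; split.
  - rewrite -[4 + _]/((cost (Defs.Sub (Reg 1) (var i))).+1 + (t1 + 4)).
    apply: (@exec_WhileTrue _ _ _ _ (t1 + 4) (set_reg s1 (10 + i) x.+1)) => //.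
      rewrite /= -/(10 + i) hx; case: g => [[-> _ _ _ _] _ _].
      by rewrite -xk; lia.
    apply: exec_Seq ex1 _; have ev : eval s1 (Add (var i) (Const 1)) = x.+1.
      by rewrite /= -/(10 + i) hx1 addn1.
    rewrite -ev -[4]/((cost (Add (var i) (Const 1))).+1); apply: exec_Assign.
    by rewrite ev; lia.
  - by rewrite mulSn; lia.
  - rewrite /= foldl_cat; move: g2; congr good; congr foldl.
    elim: (tuples d) M {IH IHk ex1 ex2 g g1 r1 r2} => //= v vs IHv M.
    by rewrite IHv cat_rcons.
  - by move=> k' k'i; rewrite r2 //= eqn_add2l ltn_eqF // r1 //; exact: ltnW.
have [||t [s' [ex tB g' r']]] := iter n 0 M (set_reg s (10 + i) 0) (erefl _) (good_set_reg 0 g ri).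
- by rewrite /= eqxx.
- by move=> k ki; rewrite /= eqn_add2l ltn_eqF // hp.
exists (2 + t), s'; split=> //.
- apply: exec_Seq ex; rewrite -[2]/((cost (Const 0)).+1); apply: (@exec_Assign W _ (Const 0)).
  exact: leq_ltn_trans nW.
- by move=> k ki; rewrite r' //= eqn_add2l ltn_eqF.
Qed.

(** A phase runs through all values of the loop variables and marks the entry [digits] of [array]
    wherever [guard] holds. The guard sees marks set earlier in the same phase, which the in-place
    closures exploit. *)
Record phase := Phase { guard : bexp; array : nat; digits : seq nat }.

Definition phase_body ph :=
  If (compile (guard ph)) (Store (cell (array ph) (map var (digits ph))) (Const 1)) Skip.

Definition phase_step ph v (M : marks) :=
  if bsem v M (guard ph) then set_mark M (array ph) [seq nth 0 v i | i <- digits ph] else M.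

Definition phase_sem M ph := foldl (fun M v => phase_step ph v M) M (tuples nvars).

Definition phase_ok ph :=
  [&& well_formed (guard ph), array ph < narrays, size (digits ph) == ndigits
    & all (leq^~ nvars) (digits ph)].

Definition phase_cost ph :=
  (cost (compile (guard ph)) + cost (cell (array ph) (map var (digits ph)))).+4.

Hypothesis W_large : base + narrays * n.+1 ^ ndigits < W.

Lemma cell_small j ds : j < narrays -> size ds = ndigits -> all (ltn^~ n.+1) ds ->
  base + code n.+1 j ds < W.
Proof.
move=> lj sd ad; have lt := code_bound j ad; apply: leq_ltn_trans W_large.
rewrite leq_add2l ltnW //; apply: leq_trans lt _.
by rewrite sd leq_mul2r lj orbT.
Qed.

Lemma n_small : n < W.
Proof.
apply: leq_ltn_trans W_large; apply: leq_trans (leq_addl _ _).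
apply: leq_trans (_ : n.+1 ^ 1 <= _); first by rewrite expn1.
apply: leq_trans (_ : n.+1 ^ ndigits <= _); first by rewrite leq_pexp2l.
by rewrite leq_pmull.
Qed.

Lemma phase_spec ph M s : phase_ok ph -> good M s ->
  exists t s', [/\ exec W (fors 0 nvars (phase_body ph)) s t s',
    t <= loop_cost (phase_cost ph) nvars & good (phase_sem M ph) s'].
Proof.
case/and4P=> wf lj /eqP sl al g.
have bodyP v M' s' : size v = nvars -> all (ltn^~ n) v -> good M' s' -> has_vars s' v ->
    exists t s2, [/\ exec W (phase_body ph) s' t s2, t <= phase_cost ph,
      good (phase_step ph v M') s2 & reg s2 = reg s'].
  move=> sv av g' hv; have ec := eval_compile g' hv sv av wf.
  rewrite /phase_step; case: ifP ec => [_ ec|_ ec].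
    have ea := eval_cell_vars (array ph) g' hv sv al.
    exists ((cost (compile (guard ph))).+1 +
      (cost (cell (array ph) (map var (digits ph))) + cost (Const 1)).+1).
    exists (set_mem s' (eval s' (cell (array ph) (map var (digits ph)))) 1); split=> //.
    - apply: exec_IfTrue; first by rewrite ec.
      apply: (@exec_Store W (cell _ _) (Const 1)); last first.
        by apply: leq_ltn_trans W_large; rewrite /= /base.
      rewrite ea; apply: cell_small => //; first by rewrite size_map.
      exact: digits_small.
    - by rewrite /phase_cost /=; lia.
    - rewrite ea; apply: good_set_mark => //; first by rewrite size_map.
      exact: digits_small.
  exists ((cost (compile (guard ph))).+1 + 1), s'; split=> //.
    by apply: exec_IfFalse => //; exact: exec_Skip.
  by rewrite /phase_cost /=; lia.
have [//|t [s' [ex tB g' _]]] :=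
  @fors_spec _ _ _ n_small bodyP nvars 0 [::] M s erefl erefl isT g.
by exists t, s'.
Qed.

Definition answer_cell := cell narrays.-1 (nseq ndigits (Reg 18)).

Definition run_phases phs :=
  foldr (fun ph c => Seq (fors 0 nvars (phase_body ph)) c)
        (Assign 0 (Defs.Mem answer_cell)) phs.

Lemma run_phases_spec phs M s : all phase_ok phs -> good M s ->
  exists t s', [/\ exec W (run_phases phs) s t s',
    t <= (cost answer_cell).+2 + sumn [seq loop_cost (phase_cost ph) nvars | ph <- phs]
    & reg s' 0 = foldl phase_sem M phs narrays.-1 (nseq ndigits 0)].
Proof.
elim: phs M s => [|ph phs IH] M s /=.
  move=> _ g; exists (cost answer_cell).+2, (set_reg s 0 (eval s (Defs.Mem answer_cell))).
  have ev : eval s (Defs.Mem answer_cell) = M narrays.-1 (nseq ndigits 0).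
    rewrite -[LHS]/(Defs.mem s (eval s answer_cell)) eval_cell.
    have r18 : eval s (Reg 18) = 0 by case: g => [[]].
    by rewrite map_nseq r18; case: g => [[_ -> -> _ _] _ h]; exact: h.
  split; rewrite ?addn0 //.
  apply: exec_Assign; rewrite ev; apply: leq_ltn_trans W_large.
  by case: (M _ _); rewrite // /base; lia.
case/andP=> okp okps /(phase_spec okp)[t [s1 [ex tB g]]].
have [t' [s2 [ex' tB' r]]] := IH _ _ okps g.
exists (t + t'), s2; split=> //; first exact: exec_Seq ex ex'.
by rewrite addnCA leq_add.
Qed.
End Machine.

(** Register 10 counts the arcs; arc number [i] has its tail at address [2 + 2 * i] and its head at
    [3 + 2 * i]. *)
Definition arc_cell :=
  cell 0 ([:: Defs.Mem (Add (Const 2) (Add (Reg 10) (Reg 10)));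
              Defs.Mem (Add (Const 3) (Add (Reg 10) (Reg 10)))] ++ nseq 5 (Reg 18)).

Definition read_arcs :=
  Seq (Assign 10 (Const 0))
      (While (Defs.Sub (Reg 4) (Reg 10))
         (Seq (Store arc_cell (Const 1)) (Assign 10 (Add (Reg 10) (Const 1))))).

Definition init :=
  Seq (Assign 1 (Defs.Mem (Const 0)))
 (Seq (Assign 4 (Defs.Mem (Const 1)))
 (Seq (Assign 3 (Add (Reg 1) (Const 1)))
      (Assign 2 (Add (Const 2) (Add (Reg 4) (Reg 4)))))).

Definition program phs := Seq init (Seq read_arcs (run_phases phs)).

(** * Reading the input and running all phases *)

Section Program.
Variables (n : nat) (arcs : seq ('I_n * 'I_n)) (W : nat).
Let m := size arcs.
Hypothesis W_large : base m + narrays * n.+1 ^ ndigits < W.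

Let input := Defs.mem (input_state arcs).

Definition arc_digits (p : 'I_n * 'I_n) : seq nat := [:: val p.1, val p.2 & nseq 5 0].

Definition arc_marks (l : seq ('I_n * 'I_n)) : marks :=
  foldl (fun M p => set_mark M 0 (arc_digits p)) (fun _ _ => false) l.

Lemma arc_marksE l j ds : arc_marks l j ds = (j == 0) && (ds \in map arc_digits l).
Proof.
elim/last_ind: l => [|l p IH]; first by rewrite andbF.
by rewrite /arc_marks foldl_rcons /set_mark -/(arc_marks l) IH map_rcons mem_rcons inE -andb_orr orbC.
Qed.

Lemma input_arc i (lt : i < m) p0 :
  input (2 + (i + i)) = (nth p0 arcs i).1 /\ input (3 + (i + i)) = (nth p0 arcs i).2.
Proof.
rewrite /input /m in lt *; rewrite /=.
elim: (arcs) i lt => //= p l IH [|i] //= lt; rewrite addnS /=.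
exact: IH.
Qed.

Lemma n1_small : n.+1 < W.
Proof.
apply: leq_trans W_large; rewrite ltnS /base.
suff : n.+1 <= n.+1 ^ ndigits by rewrite /narrays; lia.
by rewrite -{1}[n.+1]expn1 leq_pexp2l.
Qed.

Lemma init_spec : exists t s, [/\ exec W init (input_state arcs) t s, t <= 16
  & good n m input (arc_marks [::]) s].
Proof.
pose s0 := input_state arcs.
pose s1 := set_reg s0 1 n; pose s2 := set_reg s1 4 m.
pose s3 := set_reg s2 3 (n + 1); pose s4 := set_reg s3 2 (base m).
exists (3 + (3 + (4 + 6))), s4; split=> //.
  have n1 := n1_small; have bW : base m < W by apply: leq_ltn_trans W_large; exact: leq_addr.
  apply: (@exec_Seq _ _ _ _ _ s1).
    by apply: (@exec_Assign W 1 (Defs.Mem (Const 0)) s0); rewrite /=; exact: ltnW.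
  apply: (@exec_Seq _ _ _ _ _ s2).
    apply: (@exec_Assign W 4 (Defs.Mem (Const 1)) s1); rewrite /= -/m.
    by move: bW; rewrite /base; lia.
  apply: (@exec_Seq _ _ _ _ _ s3).
    by apply: (@exec_Assign W 3 (Add (Reg 1) (Const 1)) s2); rewrite /= addn1.
  by apply: (@exec_Assign W 2 (Add (Const 2) (Add (Reg 4) (Reg 4))) s3).
split=> //; first by split; rewrite //= addn1.
(* All cells lie behind the input, where the memory is 0 by the default of [nth]. *)
move=> j ds _ _ _; rewrite arc_marksE /= andbF nth_default //.
have sz (l : seq ('I_n * 'I_n)) :
    size (flatten [seq [:: nat_of_ord p.1; nat_of_ord p.2] | p <- l]) = size l + size l.
  by elim: l => //= p l ->; rewrite addnS.
by rewrite [size _]/= sz; exact: leq_addr.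
Qed.

Lemma read_arcs_spec s : good n m input (arc_marks [::]) s ->
  exists t s', [/\ exec W read_arcs s t s', t <= 6 + m * (20 + cost arc_cell)
    & good n m input (arc_marks arcs) s'].
Proof.
move=> g; have mW : m < W.
  apply: leq_ltn_trans W_large; apply: leq_trans (leq_addr _ _).
  by rewrite /base; lia.
pose loop := While (Defs.Sub (Reg 4) (Reg 10))
         (Seq (Store arc_cell (Const 1)) (Assign 10 (Add (Reg 10) (Const 1)))).
have iter k : forall x s, x + k = m -> good n m input (arc_marks (take x arcs)) s -> reg s 10 = x ->
    exists t s', [/\ exec W loop s t s', t <= 4 + k * (20 + cost arc_cell)
      & good n m input (arc_marks arcs) s'].
  elim: k => [|k IHk] {s g} x s xk g hx.
    exists 4, s; split=> //; last by move: g; rewrite take_oversize // -/m -xk addn0.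
    rewrite -[4]/((cost (Defs.Sub (Reg 4) (Reg 10))).+1).
    apply: exec_WhileFalse; rewrite /= hx.
    by case: g => [[_ _ _ -> _] _ _]; rewrite -xk addn0 subnn.
  have lt : x < m by rewrite -xk; lia.
  have p0 : 'I_n * 'I_n by move: (lt); rewrite /m; case: (arcs) => // p _ _; exact: p.
  have [i1 i2] := input_arc lt p0; set p := nth p0 arcs x in i1 i2.
  have ec : eval s arc_cell = base m + code n.+1 0 (arc_digits p).
    rewrite eval_cell /= hx; case: (g) => [[_ -> -> _ ->] hi _].
    by rewrite !hi ?i1 ?i2 // /base; lia.
  have ad : all (ltn^~ n.+1) (arc_digits p) by rewrite /= !ltnS !(ltnW (ltn_ord _)).
  pose s1 := set_mem s (eval s arc_cell) 1.
  have g1 : good n m input (arc_marks (take x.+1 arcs)) s1.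
    rewrite (take_nth p0) // /arc_marks foldl_rcons /s1 ec.
    exact: good_set_mark.
  have [|||t2 [s2 [ex2 t2B g2]]] := IHk x.+1 (set_reg s1 10 x.+1).
  - by rewrite addSnnS.
  - exact: good_set_reg.
  - by [].
  exists (4 + ((cost arc_cell + 1).+1 + 4) + t2), s2; split=> //.
    rewrite -[4 + _]/((cost (Defs.Sub (Reg 4) (Reg 10))).+1 + ((cost arc_cell + 1).+1 + 4)).
    apply: (@exec_WhileTrue _ _ _ _ _ (set_reg s1 10 x.+1)) => //.
      rewrite /= hx; case: g => [[_ _ _ -> _] _ _].
      by rewrite -xk; lia.
    apply: (@exec_Seq _ _ _ _ _ s1).
      apply: (@exec_Store W arc_cell (Const 1)); last exact: leq_ltn_trans n1_small.
      by rewrite ec; apply: cell_small.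
    have ev : eval s1 (Add (Reg 10) (Const 1)) = x.+1 by rewrite /= hx addn1.
    rewrite -ev -[4]/((cost (Add (Reg 10) (Const 1))).+1); apply: exec_Assign.
    by rewrite ev; lia.
  by rewrite mulSn; lia.
have [||t [s' [ex tB g']]] := iter m 0 (set_reg s 10 0) (erefl _).
- by rewrite take0; exact: good_set_reg.
- by [].
exists (2 + t), s'; split=> //.
apply: exec_Seq ex; rewrite -[2]/((cost (Const 0)).+1); apply: (@exec_Assign W _ (Const 0)).
exact: leq_ltn_trans n1_small.
Qed.

Lemma program_spec phs : all phase_ok phs -> exists t s,
  [/\ exec W (program phs) (input_state arcs) t s,
      t <= 22 + m * (20 + cost arc_cell) +
           ((cost answer_cell).+2 + sumn [seq loop_cost n (phase_cost ph) nvars | ph <- phs])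
    & reg s 0 = foldl (phase_sem n) (arc_marks arcs) phs narrays.-1 (nseq ndigits 0)].
Proof.
move=> ok; have [t1 [s1 [ex1 t1B g1]]] := init_spec.
have [t2 [s2 [ex2 t2B g2]]] := read_arcs_spec g1.
have [t3 [s3 [ex3 t3B r]]] := run_phases_spec W_large ok g2.
exists (t1 + (t2 + t3)), s3; split=> //; last by lia.
by apply: exec_Seq ex1 _; apply: exec_Seq ex2 ex3.
Qed.
End Program.

(** * Semantics of the phases *)

Fixpoint unmarked j b :=
  match b with
  | BEq _ _ => true
  | BMark j' _ => j' != j
  | BNot b1 => unmarked j b1
  | BAnd b1 b2 => unmarked j b1 && unmarked j b2
  end.

Lemma bsem_unmarked j v (M M' : marks) b : unmarked j b ->
  (forall j' ds, j' != j -> M j' ds = M' j' ds) -> bsem v M b = bsem v M' b.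
Proof.
by move=> + MM; elim: b => //= [j' l jj|b IH /IH->|b IHb c IHc /andP[/IHb-> /IHc->]] //; rewrite MM.
Qed.

Section Phases.
Variable n : nat.

Lemma mem_tuples v d : (v \in tuples n d) = (size v == d) && all (ltn^~ n) v.
Proof.
elim: d v => [|d IH] [|x v] //.
  by apply/negbTE/negP => /flatten_mapP[y _ /mapP[]].
rewrite /= eqSS; apply/flatten_mapP/andP => [[y yn /mapP[v' v'd [-> ->]]]|[sv /andP[xn av]]].
  by move: yn v'd; rewrite mem_iota IH => /= -> /andP[-> ->].
exists x; first by rewrite mem_iota.
by apply: map_f; rewrite IH sv.
Qed.

Definition fold_phase ph M vs := foldl (fun M v => phase_step ph v M) M vs.

Lemma fold_phase_other ph M vs j ds : j != array ph -> fold_phase ph M vs j ds = M j ds.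
Proof.
move=> ne; rewrite /fold_phase; elim: vs M => //= v vs IH M; rewrite IH /phase_step.
by case: ifP => // _; rewrite /set_mark (negPf ne) orbF.
Qed.

Lemma fold_phase_mono ph (M : marks) vs j ds : M j ds -> fold_phase ph M vs j ds.
Proof.
rewrite /fold_phase; elim: vs M => //= v vs IH M Mj; apply: IH; rewrite /phase_step.
by case: ifP => // _; rewrite /set_mark Mj.
Qed.

Lemma phase_sem_other ph M j ds : j != array ph -> phase_sem n M ph j ds = M j ds.
Proof. exact: fold_phase_other. Qed.

(** A guard that does not read the array being filled keeps its value throughout the phase, so the
    loops compute an existential quantifier. *)
Lemma phase_sem_plain ph M ds : unmarked (array ph) (guard ph) ->
  phase_sem n M ph (array ph) ds =
  M (array ph) ds ||
  has (fun v => bsem v M (guard ph) && ([seq nth 0 v i | i <- digits ph] == ds)) (tuples n nvars).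
Proof.
move=> nm; rewrite /phase_sem; elim: (tuples _ _) M => [|v vs IH] M /=; first by rewrite orbF.
have stepE j' ds' : j' != array ph -> phase_step ph v M j' ds' = M j' ds'.
  by move=> ne; rewrite /phase_step; case: ifP => // _; rewrite /set_mark (negPf ne) orbF.
rewrite IH orbA; congr (_ || _); last first.
  by apply: eq_has => v'; rewrite (bsem_unmarked _ nm stepE).
by rewrite /phase_step; case: ifP => _ //=; rewrite ?orbF // /set_mark eqxx eq_sym.
Qed.

(* Warshall's algorithm in place, for all values of ctx in parallel: g filters
   the intermediate vertices. *)
Definition closure_phase j ctx g :=
  Phase (BAnd g (BAnd (BMark j (ctx ++ [:: 6; 0])) (BMark j (ctx ++ [:: 0; 7]))))
        j (ctx ++ [:: 6; 7]).

(** * Correctness of the in-place transitive closure *)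

Section Closure.
Variables (j : nat) (ctx : seq nat) (g : bexp) (M : marks) (G : seq nat -> nat -> bool).
Hypothesis ctx_ok : all (fun i => (0 < i <= 5) || (i == 8)) ctx.
Hypothesis g_unmarked : unmarked j g.
Hypothesis gE : forall v, size v = nvars -> bsem v M g = G [seq nth 0 v i | i <- ctx] (nth 0 v 0).

Let ph := closure_phase j ctx g.

Definition closed_path c (x y : 'I_n) := exists p : seq 'I_n,
  all (fun k : 'I_n => G c k) p /\
  path (fun u v : 'I_n => M j (c ++ [:: val u; val v])) x (rcons p y).

Lemma closed_path_trans c x k y : G c (val k) -> closed_path c x k -> closed_path c k y ->
  closed_path c x y.
Proof.
move=> Gk [p [ap pp]] [q [aq pq]]; exists (rcons p k ++ q); split.
  by rewrite all_cat all_rcons Gk ap.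
by rewrite rcons_cat cat_path pp last_rcons.
Qed.

Lemma closure_sound c (x y : 'I_n) : size c = size ctx ->
  phase_sem n M ph j (c ++ [:: val x; val y]) -> closed_path c x y.
Proof.
pose inv M1 := (forall j' ds, j' != j -> M1 j' ds = M j' ds) /\
  forall c (x y : 'I_n), size c = size ctx -> M1 j (c ++ [:: val x; val y]) -> closed_path c x y.
have i0 : inv M.
  by split=> // {}c {}x {}y sc h; exists [::]; rewrite /= h.
suff gen vs M1 : {subset vs <= tuples n nvars} -> inv M1 -> inv (fold_phase ph M1 vs).
  by have [//|_ h] := gen (tuples n nvars) M _ i0; apply: h.
elim: vs M1 => [//|v vs IH] M1 sub i1; apply: (IH (phase_step ph v M1)).
  by move=> v' v'vs; apply: sub; rewrite inE v'vs orbT.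
case: i1 => off1 h1; rewrite /phase_step; case: ifP => [/= |_]; last by split.
rewrite (bsem_unmarked v g_unmarked off1) => /and3P[gv m1 m2]; split=> [j' ds ne|{}c {}x {}y sc].
  by rewrite /set_mark (negPf ne) orbF off1.
rewrite /set_mark eqxx /= => /orP[|]; first exact: h1.
have := sub v (mem_head _ _); rewrite mem_tuples => /andP[/eqP sv av].
rewrite map_cat eqseq_cat ?size_map // => /andP[/eqP ec /= /eqP[ex ey]].
have kn : nth 0 v 0 < n by apply: (allP av); apply: mem_nth; rewrite sv.
move: m1 m2 gv; rewrite !map_cat -ec /= -ex -ey (gE sv) -ec => m1 m2 gv.
by apply: (@closed_path_trans _ _ (Ordinal kn)) => //; apply: h1.
Qed.

(** Warshall's invariant: variable 0 is the outermost loop, and after its first [K] rounds every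
    admissible path with inner vertices below [K] is marked. Marks are never erased, so updating in
    place does no harm. *)
Lemma closure_complete v0 (x y : 'I_n) : size v0 = 5 -> all (ltn^~ n) v0 ->
  let c := [seq nth 0 (0 :: v0) i | i <- ctx] in
  closed_path c x y -> phase_sem n M ph j (c ++ [:: val x; val y]).
Proof.
move=> sv0 av0 c; pose F K := fold_phase ph M
  (flatten [seq map (cons k) (tuples n 7) | k <- iota 0 K]).
suff H K x' y' p : K <= n -> all (fun k : 'I_n => G c k) p -> all (fun k : 'I_n => k < K) p ->
   path (fun u v : 'I_n => M j (c ++ [:: val u; val v])) x' (rcons p y') ->
   F K j (c ++ [:: val x'; val y']).
  by case=> p [ap pp]; apply: (H n x y p) => //; apply/allP=> k _; exact: ltn_ord.
elim: K x' y' p => [|K IH] x' y' p Kn ap lp pp.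
  case: p lp ap pp => [|k p] //= _ _; by rewrite andbT.
have FS : F K.+1 = fold_phase ph (F K) (map (cons K) (tuples n 7)).
  have eK : iota 0 K.+1 = iota 0 K ++ [:: K] by rewrite -addn1 iotaD.
  rewrite /F eK map_cat flatten_cat [flatten [seq _ | k <- [:: K]]]/= cats0.
  by rewrite /fold_phase foldl_cat.
(* A simple interior contains [K] at most once, so the parts before and after it have inner vertices
   below [K]. *)
have [q [pq uq sq _]] := shorten_inner pp.
have aq : all (fun k : 'I_n => G c k) q by apply/allP=> k /sq; exact: (allP ap).
have lq : all (fun k : 'I_n => k < K.+1) q by apply/allP=> k /sq; exact: (allP lp).
have [kq|nq] := boolP (has (fun k : 'I_n => val k == K) q); last first.
  rewrite FS; apply: fold_phase_mono; apply: (IH _ _ q) => //; first exact: ltnW.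
  apply/allP=> k kq; have := allP lq k kq; rewrite ltnS leq_eqVlt => /orP[ek|//].
  by case/hasP: nq; exists k.
case/hasP: kq => k kq /eqP ek; case/splitPr: kq pq uq aq lq {sq} => q1 q2.
rewrite rcons_cat cat_path rcons_cons => /= pq uq aq lq.
have nk k' : k' \in q1 ++ q2 -> val k' != K.
  move=> k'q; rewrite -ek; apply: contraL uq => /eqP/val_inj kk.
  by rewrite -cat1s uniq_catCA /= -kk k'q.
have mem_lt q' : {subset q' <= q1 ++ q2} -> all (fun k : 'I_n => k < K) q'.
  move=> sub; apply/allP=> k' /sub k'q.
  have : k' < K.+1 by apply: (allP lq); move: k'q; rewrite !mem_cat inE => /orP[]->; rewrite ?orbT.
  by rewrite ltnS leq_eqVlt (negPf (nk _ k'q)).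
move: aq; rewrite all_cat /= => /and3P[aq1 Gk aq2].
case/and3P: pq => pq1 lk pq2.
have m1 K' : val k = K' -> F K j (c ++ [:: val x'; K']).
  move=> <-;  apply: (IH _ _ q1) => //; first exact: ltnW.
    by apply: mem_lt => k' k'q; rewrite mem_cat k'q.
  by rewrite rcons_path pq1.
have m2 K' : val k = K' -> F K j (c ++ [:: K'; val y']).
  move=> <-;  apply: (IH _ _ q2) => //; first exact: ltnW.
  by apply: mem_lt => k' k'q; rewrite mem_cat k'q orbT.
(* The values of variables 1 to 7 for which round [K] joins the two parts. *)
pose w := v0 ++ [:: val x'; val y'].
have sw : size w = 7 by rewrite size_cat sv0.
have wT : w \in tuples n 7.
  by rewrite mem_tuples sw all_cat av0 /= !ltn_ord.
have ctxE : [seq nth 0 (K :: w) i | i <- ctx] = c.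
  apply/eq_in_map => i /(allP ctx_ok) /orP[/andP[i0 i5]|/eqP->].
    by case: i i0 i5 => // i _ i5; rewrite /w /= nth_cat sv0 i5.
  by rewrite !nth_default //= ?sv0 ?sw.
rewrite FS; case/splitPr: wT => t1 t2; rewrite map_cat /= /fold_phase foldl_cat.
rewrite -/(fold_phase ph (F K) (map (cons K) t1)).
set M1 := fold_phase ph (F K) (map (cons K) t1).
suff : phase_step ph (K :: w) M1 j (c ++ [:: val x'; val y']).
  exact: (@fold_phase_mono ph).
have off1 j' ds : j' != j -> M1 j' ds = M j' ds.
  by move=> ne; rewrite /M1 fold_phase_other // /F fold_phase_other.
have guardT : bsem (K :: w) M1 (guard ph).
  have sKw : size (K :: w) = nvars by rewrite /= sw.
  rewrite /= (bsem_unmarked _ g_unmarked off1) (gE sKw) !map_cat ctxE /=.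
  have -> /= : G c K by rewrite -ek.
  have w5 : nth 0 w 5 = x' by rewrite nth_cat sv0.
  have w6 : nth 0 w 6 = y' by rewrite nth_cat sv0.
  rewrite w5 w6; apply/andP; split.
    exact: (@fold_phase_mono ph (F K) _ _ _ (m1 _ ek)).
  exact: (@fold_phase_mono ph (F K) _ _ _ (m2 _ ek)).
rewrite /phase_step guardT /set_mark /= eqxx !map_cat ctxE //=.
have w5 : nth 0 w 5 = x' by rewrite nth_cat sv0.
have w6 : nth 0 w 6 = y' by rewrite nth_cat sv0.
by rewrite w5 w6 eqxx orbT.
Qed.
End Closure.
End Phases.

(** * The algorithm *)

(** Array 0 holds the arcs, 1 reachability avoiding [a] and two further vertices, 2 the essential
    vertices, 3 the tuples separated by a single vertex, 4 the paths without essential inner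
    vertices, 5 the even walks of cuts, and 6 the answer. *)
Definition b_arc x y := BMark 0 [:: x; y; 8; 8; 8; 8; 8].
Definition b_reach u w x y := BMark 1 [:: 1; u; w; 8; 8; x; y].
Definition b_essential u := BMark 2 [:: 1; 2; 3; 4; 5; u; 8].
(** Variables 2 and 3 are [s1], [s2]; 4 and 5 are [t1], [t2]. *)
Definition b_cut u w :=
  BAnd (BAnd (BNot (b_reach u w 2 4)) (BNot (b_reach u w 2 5)))
       (BAnd (BNot (b_reach u w 3 4)) (BNot (b_reach u w 3 5))).
Definition b_avoids x := BAnd (BNot (BEq x 1)) (BAnd (BNot (BEq x 2)) (BNot (BEq x 3))).
Definition b_or b c := BNot (BAnd (BNot b) (BNot c)).
Definition b_true := BEq 8 8.

(* Variable 0 is the intermediate vertex of the closures and the existential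
   witness; 1, ..., 5 are a, s1, s2, t1, t2 (in the phases of array 1: a, u, w
   and two idle variables); 6 and 7 range over the pairs of vertices. *)
Definition phases := [::
  Phase (BAnd (BAnd (b_avoids 6) (b_avoids 7)) (b_or (BEq 6 7) (b_arc 6 7)))
        1 [:: 1; 2; 3; 8; 8; 6; 7];
  closure_phase 1 [:: 1; 2; 3; 8; 8] b_true;
  Phase (b_cut 6 7) 2 [:: 1; 2; 3; 4; 5; 6; 8];
  Phase (b_cut 6 6) 3 [:: 1; 2; 3; 4; 5; 8; 8];
  Phase (BAnd (b_arc 6 7) (BAnd (BNot (BEq 6 1)) (BNot (BEq 7 1)))) 4 [:: 1; 2; 3; 4; 5; 6; 7];
  closure_phase 4 [:: 1; 2; 3; 4; 5] (BNot (b_essential 0));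
  Phase (BAnd (b_cut 6 0) (b_cut 0 7)) 5 [:: 1; 2; 3; 4; 5; 6; 7];
  closure_phase 5 [:: 1; 2; 3; 4; 5] b_true;
  Phase (BAnd (BAnd (BAnd (b_arc 1 2) (b_arc 1 3)) (BAnd (b_arc 4 1) (b_arc 5 1)))
        (BAnd (BAnd (BNot (BMark 3 [:: 1; 2; 3; 4; 5; 8; 8])) (BNot (b_essential 0)))
        (BAnd (BAnd (b_essential 6) (b_essential 7))
        (BAnd (BAnd (BMark 4 [:: 1; 2; 3; 4; 5; 6; 0]) (BMark 4 [:: 1; 2; 3; 4; 5; 0; 7]))
              (BNot (BMark 5 [:: 1; 2; 3; 4; 5; 6; 7]))))))
        6 [:: 8; 8; 8; 8; 8; 8; 8]].

(** * Meaning of each array and correctness of the answer *)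

Section Correctness.
Variables (n : nat) (D : digraph 'I_n) (arcs : seq ('I_n * 'I_n)).
Hypothesis arcsE : perm_eq arcs (enum (arc_pred D)).

Let M i := foldl (phase_sem n) (arc_marks arcs) (take i phases).

Lemma M_succ i ph : onth phases i = Some ph -> M i.+1 = phase_sem n (M i) ph.
Proof.
rewrite /M => h; have lt : i < size phases by case: leqP h => // /onth_default->.
rewrite (take_nth ph) // foldl_rcons; congr phase_sem.
by apply: onth_nth; rewrite h.
Qed.

Lemma M_const j i k ds : all (fun ph => array ph != j) (take k (drop i phases)) ->
  M (i + k) j ds = M i j ds.
Proof.
rewrite /M takeD foldl_cat; move: (foldl _ _ (take i phases)) => M0.
elim: (take k _) M0 => //= ph phs IH M0 /andP[ne /IH->].
by rewrite phase_sem_other // eq_sym.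
Qed.

Lemma M_false j i ds : j != 0 -> all (fun ph => array ph != j) (take i phases) -> M i j ds = false.
Proof.
move=> j0 al; have -> : M i j ds = M 0 j ds by rewrite -[i]add0n M_const ?drop0.
by rewrite /M take0 /= arc_marksE (negPf j0).
Qed.

Lemma ords_of (v : seq nat) : all (ltn^~ n) v -> exists s : seq 'I_n, v = map val s.
Proof.
elim: v => [|x v IH] /=; first by exists [::].
by case/andP=> xn /IH[s ->]; exists (Ordinal xn :: s).
Qed.

(** The entry is empty before the phase, so its mark can only come from some values of the loop
    variables, given here as eight vertices. *)
Lemma M_plain i ph ds : onth phases i = Some ph -> unmarked (array ph) (guard ph) ->
  M i (array ph) ds = false ->
  reflect (exists z0 z1 z2 z3 z4 z5 z6 z7 : 'I_n, let v : seq nat := [:: val z0; val z1; val z2; val z3; val z4; val z5; val z6; val z7] in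
             bsem v (M i) (guard ph) /\ [seq nth 0 v i | i <- digits ph] = ds)
          (M i.+1 (array ph) ds).
Proof.
move=> e um f; rewrite (M_succ e) phase_sem_plain // f orFb; apply: (iffP hasP).
  case=> v; rewrite mem_tuples => /andP[/eqP sv /ords_of[s es]] /andP[bv /eqP ed].
  move: sv bv ed; rewrite es size_map.
  case: s {es} => [|z0 [|z1 [|z2 [|z3 [|z4 [|z5 [|z6 [|z7 [|? ?]]]]]]]]] //= _ bv ed.
  by exists z0, z1, z2, z3, z4, z5, z6, z7.
case=> z0 [z1 [z2 [z3 [z4 [z5 [z6 [z7 [bv ed]]]]]]]].
eexists; last by apply/andP; split; [exact: bv|apply/eqP; exact: ed].
by rewrite mem_tuples /= !ltn_ord.
Qed.

Lemma M_arc i (x y : 'I_n) : M i 0 [:: val x; val y; 0; 0; 0; 0; 0] = Defs.arc D x y.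
Proof.
have -> ds : M i 0 ds = M 0 0 ds.
  rewrite -[i]add0n M_const // drop0.
  have : all (fun ph => array ph != 0) phases by [].
  by rewrite -{1}(cat_take_drop i phases) all_cat => /andP[].
rewrite /M take0 /= arc_marksE eqxx /=.
transitivity ((x, y) \in arcs); last by rewrite (perm_mem arcsE) mem_enum.
apply/mapP/idP => [[[x' y'] xy [/val_inj-> /val_inj->]] //|xy].
by exists (x, y).
Qed.

Definition avoids (a u w x : 'I_n) := [&& x != a, x != u & x != w].

Lemma M_reach_init (a u w x y : 'I_n) : M 1 1 [:: val a; val u; val w; 0; 0; val x; val y] =
  [&& avoids a u w x, avoids a u w y & (x == y) || Defs.arc D x y].
Proof.
apply/(@M_plain 0 _ _ erefl erefl (M_false _ _ _))/idP => //=.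
  case=> z0 [z1 [z2 [z3 [z4 [z5 [z6 [z7 [bv [/val_inj e1 /val_inj e2 /val_inj e3 /val_inj e6 /val_inj e7]]]]]]]]].
  subst; move: bv; rewrite M_arc negb_and !negbK => /andP[/andP[ax ay] xy].
  by rewrite /avoids ax ay xy.
move=> /and3P[ax ay xy]; exists x, a, u, w, x, x, x, y; split=> //.
by rewrite M_arc negb_and !negbK -/(avoids a u w x) -/(avoids a u w y) ax ay xy.
Qed.

(** A finished table can be read at every later stage; hence indices such as [2 + k] for stages. *)
Lemma M_stable j i k ds : all (fun ph => array ph != j) (drop i phases) ->
  M (i + k) j ds = M i j ds.
Proof.
by rewrite -{1}(cat_take_drop k (drop i phases)) all_cat => /andP[h _]; apply: M_const.
Qed.

(** The initial marks are reflexive, so the closure also contains walks without arcs; conversely,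
    repeated vertices coming from reflexive marks are dropped. *)
Lemma M_reach k (a u w x y : 'I_n) :
  M (2 + k) 1 [:: val a; val u; val w; 0; 0; val x; val y] <->
  exists q, [/\ path (away D a) x q, last x q = y & all (avoids a u w) (x :: q)].
Proof.
rewrite M_stable // (@M_succ 1 _ erefl).
pose G (c : seq nat) (k : nat) := true.
have gE v : size v = nvars -> bsem v (M 1) b_true = G [seq nth 0 v i | i <- [:: 1; 2; 3; 8; 8]] (nth 0 v 0).
  by move=> _; rewrite /= eqxx.
pose c : seq nat := [:: val a; val u; val w; 0; 0].
have -> : [:: val a; val u; val w; 0; 0; val x; val y] = c ++ [:: val x; val y] by [].
split=> [/(@closure_sound _ 1 _ b_true (M 1) G isT gE c _ _ erefl)[p [_ pp]]|[q [pq lq aq]]].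
  elim: p x pp => [|z p IH] x /=; rewrite M_reach_init => /andP[/and3P[ax az xz]].
    move=> _; case/orP: xz => [/eqP exy|xy]; first by exists [::]; rewrite /= exy in ax *; rewrite ax.
    by exists [:: y]; rewrite /= ax az /away xy; case/and3P: ax => ->; case/and3P: az => ->.
  case/IH=> q [pq lq aq]; case/orP: xz => [/eqP->|xz]; first by exists q.
  exists (z :: q); split=> //; first by rewrite /= pq /away xz; case/and3P: ax => ->; case/and3P: az => ->.
  by rewrite /= ax; move: aq.
(* The idle variables 4 and 5 are given the value [a]. *)
have lt : all (ltn^~ n) [:: val a; val u; val w; val a; val a] by rewrite /= !ltn_ord.
apply: (@closure_complete n 1 [:: 1; 2; 3; 8; 8] b_true (M 1) G isT isT gE
  [:: val a; val u; val w; val a; val a] x y erefl lt).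
have step z z' : avoids a u w z -> avoids a u w z' -> (z == z') || Defs.arc D z z' ->
    M 1 1 (c ++ [:: val z; val z']).
  by move=> az az' zz'; rewrite M_reach_init az az'.
elim: q x pq lq aq => [|z q IH] x /=.
  move=> _ <- /andP[ax _]; exists [::]; split=> //=.
  by rewrite andbT; apply: step; rewrite ?ax ?eqxx.
case/andP=> /and3P[xz xa za] pz lz /andP[ax az].
have [p [_ pp]] := IH z pz lz az; exists (z :: p); split; first by apply/allP.
rewrite rcons_cons /= pp andbT; apply: step; rewrite ?ax ?xz ?orbT //.
by case/andP: az.
Qed.

Section Tuple.
Variables a s1 s2 t1 t2 : 'I_n.
Hypotheses (s1a : s1 != a) (s2a : s2 != a).

Let cut_a := cut (away D a) s1 s2 t1 t2.
Let essential_a := essential (away D a) s1 s2 t1 t2.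
Let R k (u w x y : 'I_n) := M (2 + k) 1 [:: val a; val u; val w; 0; 0; val x; val y].

(** Reachability is tabulated in [D] without [a], [u] and [w]. A walk of [away D a] from [s1] or
    [s2] never meets [a], so only [u] and [w] matter. *)
Lemma cut_marks k (u w : 'I_n) :
  (~~ R k u w s1 t1 && ~~ R k u w s1 t2) && (~~ R k u w s2 t1 && ~~ R k u w s2 t2) <-> cut_a u w.
Proof.
have noR s t : cut_a u w -> pred2 s1 s2 s -> pred2 t1 t2 t -> ~~ R k u w s t.
  move=> c Ss Tt; apply/negP => /M_reach[q [pq lq /allP aq]].
  have /c : walk (away D a) (pred2 s1 s2) (pred2 t1 t2) (s :: q) by apply/and3P; rewrite lq.
  by case=> /aq; rewrite /avoids eqxx ?andbF.
split=> [|c]; last by rewrite !noR //= eqxx ?orbT.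
move=> h; case=> // s q /and3P[Ss pq Tt]; apply/orP/negPn/negP => /norP[uq wq].
suff r : R k u w s (last s q).
  by move: h; case/orP: Tt r => /eqP->; case/orP: Ss => /eqP-> ->; rewrite ?andbF.
apply/M_reach; exists q; split=> //; apply/allP=> v vq; rewrite /avoids.
have -> : v != u by apply: contraNneq uq => <-.
have -> : v != w by apply: contraNneq wq => <-.
rewrite !andbT; have sa : s != a by case/orP: Ss => /eqP->.
have : a \notin s :: q; last by apply: contraNneq => <-.
exact: away_notin sa pq.
Qed.

Lemma M_essential k (u : 'I_n) :
  M (3 + k) 2 [:: val a; val s1; val s2; val t1; val t2; val u; 0] <-> essential_a u.
Proof.
rewrite M_stable //; split.
  case/(@M_plain 2 _ _ erefl erefl (@M_false 2 2 _ isT isT)).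
  move=> z0 [z1 [z2 [z3 [z4 [z5 [z6 [z7 [bv [/val_inj e1 /val_inj e2 /val_inj e3 /val_inj e4 /val_inj e5 /val_inj e6]]]]]]]]].
  by subst; exists z7; apply/(cut_marks 0).
case=> w /(cut_marks 0) c; apply/(@M_plain 2 _ _ erefl erefl (@M_false 2 2 _ isT isT)).
by exists u, a, s1, s2, t1, t2, u, w.
Qed.

Lemma M_separable k : M (4 + k) 3 [:: val a; val s1; val s2; val t1; val t2; 0; 0] <->
  exists z, cut_a z z.
Proof.
rewrite M_stable //; split.
  case/(@M_plain 3 _ _ erefl erefl (@M_false 3 3 _ isT isT)).
  move=> z0 [z1 [z2 [z3 [z4 [z5 [z6 [z7 [bv [/val_inj e1 /val_inj e2 /val_inj e3 /val_inj e4 /val_inj e5]]]]]]]]].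
  by subst; exists z6; apply/(cut_marks 1).
case=> w /(cut_marks 1) c; apply/(@M_plain 3 _ _ erefl erefl (@M_false 3 3 _ isT isT)).
by exists w, a, s1, s2, t1, t2, w, w.
Qed.

Let tup : seq nat := [:: val a; val s1; val s2; val t1; val t2].

Lemma M_free k (x y : 'I_n) : M (6 + k) 4 (tup ++ [:: val x; val y]) <->
  exists p, (forall v, v \in p -> ~ essential_a v) /\ path (away D a) x (rcons p y).
Proof.
rewrite M_stable // (@M_succ 5 _ erefl).
have init (u v : 'I_n) : M 5 4 (tup ++ [:: val u; val v]) = away D a u v.
  apply/(@M_plain 4 _ _ erefl erefl (@M_false 4 4 _ isT isT))/idP => /=.
    case=> z0 [z1 [z2 [z3 [z4 [z5 [z6 [z7 [bv [/val_inj e1 /val_inj e2 /val_inj e3 /val_inj e4 /val_inj e5 /val_inj e6 /val_inj e7]]]]]]]]].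
    by subst; move: bv; rewrite M_arc.
  by move=> uv; exists u, a, s1, s2, t1, t2, u, v; rewrite M_arc.
pose G (c : seq nat) (k : nat) := ~~ M 5 2 (c ++ [:: k; 0]).
have gE v : size v = nvars -> bsem v (M 5) (BNot (b_essential 0)) =
    G [seq nth 0 v i | i <- [:: 1; 2; 3; 4; 5]] (nth 0 v 0).
  by case: v => [|? [|? [|? [|? [|? [|? [|? [|? [|? ?]]]]]]]]].
have GE (v : 'I_n) : G tup (val v) <-> ~ essential_a v.
  by rewrite /G; split=> [/negP h /(M_essential 2)//|h]; apply/negP => /(M_essential 2).
split=> [/(@closure_sound _ 4 [:: 1; 2; 3; 4; 5] (BNot (b_essential 0)) (M 5) G isT gE tup _ _ erefl)[p [ap pp]]|[p [ap pp]]].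
  exists p; split; first by move=> v /(allP ap) /GE.
  by rewrite -(eq_path (e := fun u v => M 5 4 (tup ++ [:: val u; val v]))).
have lt : all (ltn^~ n) tup by rewrite /= !ltn_ord.
apply: (@closure_complete n 4 [:: 1; 2; 3; 4; 5] (BNot (b_essential 0)) (M 5) G isT isT gE tup x y erefl lt).
exists p; split; first by apply/allP=> v /ap /GE.
by rewrite (eq_path (e' := away D a)).
Qed.

Lemma M_linked k (x y : 'I_n) : M (8 + k) 5 (tup ++ [:: val x; val y]) <->
  exists p, path (fun u w => M 7 5 (tup ++ [:: val u; val w])) x (rcons p y).
Proof.
rewrite M_stable // (@M_succ 7 _ erefl).
pose G (c : seq nat) (k : nat) := true.
have gE v : size v = nvars -> bsem v (M 7) b_true = G [seq nth 0 v i | i <- [:: 1; 2; 3; 4; 5]] (nth 0 v 0).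
  by move=> _; rewrite /= eqxx.
split=> [/(@closure_sound _ 5 _ b_true (M 7) G isT gE tup _ _ erefl)[p [_ pp]]|[p pp]]; first by exists p.
have lt : all (ltn^~ n) tup by rewrite /= !ltn_ord.
apply: (@closure_complete n 5 [:: 1; 2; 3; 4; 5] b_true (M 7) G isT isT gE tup x y erefl lt).
by exists p; split=> //; apply/allP.
Qed.

Lemma M_link (x y : 'I_n) : M 7 5 (tup ++ [:: val x; val y]) <-> exists z, cut_a x z /\ cut_a z y.
Proof.
split.
  case/(@M_plain 6 _ _ erefl erefl (@M_false 5 6 _ isT isT)).
  move=> z0 [z1 [z2 [z3 [z4 [z5 [z6 [z7 [bv [/val_inj e1 /val_inj e2 /val_inj e3 /val_inj e4 /val_inj e5 /val_inj e6 /val_inj e7]]]]]]]]].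
  by subst; case/andP: bv => c1 c2; exists z0; split; apply/(cut_marks 4).
case=> z [/(cut_marks 4) c1 /(cut_marks 4) c2].
apply/(@M_plain 6 _ _ erefl erefl (@M_false 5 6 _ isT isT)).
by exists z, a, s1, s2, t1, t2, x, y; split=> //; apply/andP.
Qed.
End Tuple.

Lemma phases_correct :
  foldl (phase_sem n) (arc_marks arcs) phases narrays.-1 (nseq ndigits 0) <->
  has_subdivision E9 D.
Proof.
have -> : foldl (phase_sem n) (arc_marks arcs) phases = M 9 by [].
have irr x y : Defs.arc D x y -> y != x.
  by apply: contraTneq => ->; rewrite arc_irr.
split.
  case/(@M_plain 8 _ _ erefl erefl (@M_false 6 8 _ isT isT)).
  (* The vertex [k] in variable 0 lies inside the path from [u] to [w]: it makes the interior
     nonempty and is itself not essential. *)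
  move=> k [a [s1 [s2 [t1 [t2 [u [w [bv _]]]]]]]]; move: bv.
  rewrite [bsem _ _ _]/= !M_arc.
  case/andP=> /andP[/andP[as1 as2] /andP[t1a t2a]].
  case/andP=> /andP[ns nk] /andP[/andP[eu ew] /andP[/andP[fu fw] nl]].
  have s1a := irr _ _ as1; have s2a := irr _ _ as2.
  move/(@M_essential _ _ _ _ _ s1a s2a 5): eu => eu.
  move/(@M_essential _ _ _ _ _ s1a s2a 5): ew => ew.
  case/(@M_free _ _ _ _ _ s1a s2a 2): fu => p [np pp].
  case/(@M_free _ _ _ _ _ s1a s2a 2): fw => q [nq pq].
  have {}nk : ~ essential (away D a) s1 s2 t1 t2 k.
    by move/(@M_essential _ _ _ _ _ s1a s2a 5); apply/negP.
  apply: (bridged_subdivision as1 as2 t1a t2a).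
  apply: (@bridged_of_unlinked _ _ s1 s2 t1 t2
    (fun x y => M 8 5 ([:: val a; val s1; val s2; val t1; val t2] ++ [:: val x; val y])) u w (p ++ k :: q)) => //.
  (* No mark in array 3 means that no single vertex meets all walks. *)
  - move=> z; apply: NNPP => nz; move/negP: ns; apply.
    apply/(@M_separable _ _ _ _ _ s1a s2a 4); exists z => r wr; left.
    by apply/negPn/negP => zr; apply: nz; exists r.
  - move=> x y z /(M_linked _ _ _ _ _ 0)[p1 pp1] /(M_linked _ _ _ _ _ 0)[p2 pp2].
    apply/(M_linked _ _ _ _ _ 0); exists (rcons p1 y ++ p2).
    by rewrite rcons_cat cat_path pp1 last_rcons.
  - move=> x y z xz zy; apply/(M_linked _ _ _ _ _ 0); exists [::].
    by rewrite /= andbT; apply/(M_link _ _ s1a s2a); exists z.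
  - by apply/negP.
  - by rewrite rcons_cat rcons_cons -cat_rcons cat_path pp last_rcons.
  - by case: (p).
  - by move=> v; rewrite mem_cat inE => /or3P[/np//|/eqP->|/nq].
case/subdivision_bridged=> a [s1 [s2 [t1 [t2 [as1 as2 t1a t2a]]]]].
case/unlinked_of_bridged=> sep [u [w [I [P [eu ew [pI I0] nI [Pu Pw PB]]]]]].
have s1a := irr _ _ as1; have s2a := irr _ _ as2.
apply/(@M_plain 8 _ _ erefl erefl (@M_false 6 8 _ isT isT)).
(* The first inner vertex serves as the witness in variable 0. *)
case: I I0 pI nI => // k I _; rewrite rcons_cons /= => /andP[uk kw] nI.
exists k, a, s1, s2, t1, t2, u, w; split=> //.
rewrite /= !M_arc as1 as2 t1a t2a.
have -> : M 8 2 [:: val a; val s1; val s2; val t1; val t2; val u; 0].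
  exact/(@M_essential _ _ _ _ _ s1a s2a 5).
have -> : M 8 2 [:: val a; val s1; val s2; val t1; val t2; val w; 0].
  exact/(@M_essential _ _ _ _ _ s1a s2a 5).
have -> : M 8 4 [:: val a; val s1; val s2; val t1; val t2; val u; val k].
  by apply/(@M_free _ _ _ _ _ s1a s2a 2); exists [::]; rewrite /= uk.
have -> : M 8 4 [:: val a; val s1; val s2; val t1; val t2; val k; val w].
  apply/(@M_free _ _ _ _ _ s1a s2a 2); exists I; split=> // v vI.
  by apply: nI; rewrite inE vI orbT.
have /negPf-> : ~~ M 8 2 [:: val a; val s1; val s2; val t1; val t2; val k; 0].
  by apply/negP => /(@M_essential _ _ _ _ _ s1a s2a 5); apply: nI; exact: mem_head.
have /negPf-> : ~~ M 8 3 [:: val a; val s1; val s2; val t1; val t2; 0; 0].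
  apply/negP => /(@M_separable _ _ _ _ _ s1a s2a 4)[z cz].
  by have [r /cz[] zr /negP] := sep z.
have /negPf-> // : ~~ M 8 5 [:: val a; val s1; val s2; val t1; val t2; val u; val w].
apply/negP => /(M_linked _ _ _ _ _ 0)[p].
(* Every link preserves [P], so a chain of links would carry it from [u] to [w]. *)
elim: p u Pu {eu uk} => [|v p IH] u Pu.
  rewrite /= andbT => /(M_link _ _ s1a s2a)[z [uz zw]].
  by rewrite (PB _ _ _ uz zw Pu) in Pw.
case/andP=> /(M_link _ _ s1a s2a)[z [uz zv]]; apply: IH.
exact: PB uz zv Pu.
Qed.
End Correctness.

(** * Running time and word length *)

Lemma time_bound : exists C, forall n m, 0 < n ->
  22 + m * (20 + cost arc_cell) +
    ((cost answer_cell).+2 + sumn [seq loop_cost n (phase_cost ph) nvars | ph <- phases])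
  <= C * (n ^ 7 * (n + m)).
Proof.
pose c1 := cost arc_cell; pose c2 := cost answer_cell.
pose c3 := sumn [seq phase_cost ph + 14 * nvars | ph <- phases].
exists (22 + (20 + c1) + (c2.+2 + c3)) => n m n0.
have le_sum phs : sumn [seq loop_cost n (phase_cost ph) nvars | ph <- phs] <=
    sumn [seq phase_cost ph + 14 * nvars | ph <- phs] * n ^ nvars.
  by move: nvars => d; elim: phs => //= ph phs IH; rewrite mulnDl leq_add // loop_cost_bound.
have := le_sum phases; rewrite -/c3 -/c1 -/c2 => le3.
have n7 : 0 < n ^ 7 by rewrite expn_gt0 n0.
(* The loop nests cost a multiple of [n ^ 8]; the time for reading the arcs, linear in [m], is
   absorbed because [n] is positive. *)
have n8 : n ^ nvars <= n ^ 7 * (n + m) by rewrite /nvars expnSr leq_mul2l leq_addr orbT.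
have le2 : m <= n ^ 7 * (n + m) by apply: leq_trans (leq_addl n m) _; exact: leq_pmull.
have le1 : 1 <= n ^ 7 * (n + m) by rewrite muln_gt0 n7 addn_gt0 n0.
move: (n ^ 7 * (n + m)) n8 le2 le1 => X n8 le2 le1.
apply: leq_trans (_ : 22 * X + (20 + c1) * X + (c2.+2 * X + c3 * X) <= _); last by rewrite !mulnDl.
apply: leq_add; apply: leq_add.
- by rewrite leq_pmulr.
- by rewrite mulnC leq_mul2l le2 orbT.
- by rewrite leq_pmulr.
- by apply: leq_trans le3 _; rewrite leq_mul2l n8 orbT.
Qed.

(** With [q = n + m + 2], the left side is at most [2 * q ^ 7 + 7 * q ^ 7], and [16 <= q ^ 5] since
    [q >= 2]; hence the exponent [12 = 7 + 5]. *)
Lemma word_bound n m : base m + narrays * n.+1 ^ ndigits < (n + m + 2) ^ 12.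
Proof.
set q := n + m + 2; have q2 : 2 <= q by rewrite /q; lia.
have b1 : base m <= 2 * q by rewrite /base /q; lia.
have b2 : n.+1 ^ ndigits <= q ^ 7 by rewrite leq_exp2r // /q; lia.
have b3 : 2 * q <= q ^ 7 * 2.
  by rewrite mulnC leq_mul2r /= -{1}[q]expn1 leq_pexp2l //; lia.
have b4 : q ^ 7 * 16 <= q ^ 12 - 0.
  rewrite subn0 -[12]/(7 + 5) expnD leq_mul2l; apply/orP; right.
  apply: leq_trans (_ : 2 ^ 5 <= _) => //; by rewrite leq_exp2r.
have p7 : 0 < q ^ 7 by rewrite expn_gt0; apply/orP; left; lia.
move: (q ^ 7) (q ^ 12) (n.+1 ^ ndigits) b1 b2 b3 b4 p7 => X Y Z; rewrite /narrays; lia.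
Qed.

Theorem theorem29 :
  solvable_in_time (fun n (D : digraph 'I_n) => has_subdivision E9 D)
                   (fun n m => n ^ 7 * (n + m)).
Proof.
have [C CP] := time_bound.
exists (program phases), 12, C => n D arcs arcsE.
have em : size arcs = narcs D by rewrite (perm_size arcsE) -cardE.
have [|t [s [ex tB r]]] := @program_spec n arcs ((n + narcs D + 2) ^ 12) _ phases isT.
  by rewrite em; exact: word_bound.
exists t, s; split=> //.
  rewrite r -(phases_correct arcsE); case: (foldl _ _ _ _ _); split=> //.
by move=> n0; apply: leq_trans tB _; rewrite em; apply: CP.
Qed.
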